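(* Let $\mathcal{U}\subset\mathbb{C}^n$ be a connected open set, $X$ a holomorphic vector field on $\mathcal{U}$ and $a_1,\dots,a_p\in\mathbb{C}^*$ such that $(a_1X,a_2X,\dots,a_pX)$ is a rigid $p$-chambar on $\mathcal{U}$. Then the flow $\exp tX$ of $X$ is polynomial of degree at most $p-1$ as a function of the time $t$. In particular, the orbits of $X$ are contained in rational curves.
   Context: For a holomorphic vector field $X$ on an open set $\mathcal{U}\subset\mathbb{C}^n$, $\varphi_t=\exp(tX)$ denotes its local flow: $\frac{d}{dt}\varphi_t(x)=X(\varphi_t(x))$, $\varphi_0(x)=x$, defined for each $x\in\mathcal U$ and $t\in\mathbb{C}$ small. A $p$-chambar on $\mathcal{U}$ is a $p$-tuple of pairwise distinct, not identically zero holomorphic vector fields $X_1,\dots,X_p$ on $\mathcal{U}$ satisfying the barycentric property: $\sum_{k=1}^p X_k(\exp(tX_k)(x))=0$ for all $x\in\mathcal{U}$ and all small $t$; equivalently $\sum_{k=1}^p\exp(tX_k)(x)=p\,x$. A $p$-chambar is rigid if it has the form $(a_1X,\dots,a_pX)$ with $X$ a vector field and the $a_i$ constants. The flow is polynomial of degree at most $d$ in $t$ if $\exp(tX)(x)=x+\sum_{j=1}^{d}t^jF_j(x)$ with $F_j$ holomorphic maps on $\mathcal{U}$. An orbit reduced to a point is regarded as contained in a rational curve; otherwise ''rational curve'' refers to an algebraic curve admitting a rational parametrization. *)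

(* Defs.v *)
From mathcomp Require Import all_boot all_order all_algebra complex.
From mathcomp Require Import all_classical all_reals all_analysis.
From mathcomp Require mpoly.

Set Implicit Arguments.
Unset Strict Implicit.
Unset Printing Implicit Defensive.

Import Order.TTheory GRing.Theory Num.Theory.
Import numFieldNormedType.Exports.

Local Open Scope classical_set_scope.
Local Open Scope ring_scope.
Local Open Scope complex_scope.

(* MathComp plus MathComp-Analysis.  Complex numbers are R[i] with R : realType
   and points of C^n are row vectors.  Topology and norm are available on the
   alias R[i]^o of R[i], hence on 'rV[R[i]^o]_n; scalars being R[i], all
   differentials and derivatives below are complex ones. *)

Section Flows.
Variables (R : realType) (n : nat).
Local Notation C := (R[i]^o).
Local Notation V := ('rV[C]_n).
Implicit Types (U : set V) (X : V -> V).

Definition holomorphic_on U X := forall x, U x -> differentiable X x.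

(* phi t x stands for exp(tX)(x).  How small t has to be may depend on x; the
   values of phi for x outside U or for large t are irrelevant.  For X
   holomorphic on an open U such a phi exists, and t |-> phi t x is unique as a
   germ at 0. *)
Definition local_flow U X (phi : C -> V -> V) := forall x, U x ->
  phi 0 x = x /\
  \forall t \near (0 : C),
    U (phi t x) /\ is_derive t (1 : C) (phi ^~ x) (X (phi t x)).

(* The barycentric property does not depend on the choice of phi, the local
   flow being unique as a germ at t = 0. *)
Definition chambar (p : nat) U (X : 'I_p -> V -> V) :=
  [/\ forall k, holomorphic_on U (X k),
      forall k, exists2 x, U x & X k x != 0,
      forall k l, k != l -> exists2 x, U x & X k x != X l x &
      exists phi : 'I_p -> C -> V -> V,
        (forall k, local_flow U (X k) (phi k)) /\
        forall x, U x -> \forall t \near (0 : C),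
          \sum_(k < p) X k (phi k t x) = 0].

Definition poly_in_time (d : nat) (F : nat -> V -> V) (t : C) (x : V) : V :=
  x + \sum_(1 <= j < d.+1) t ^+ j *: F j x.

Definition polynomial_flow (d : nat) U X := exists F : nat -> V -> V,
  [/\ forall j, holomorphic_on U (F j),
      local_flow U X (poly_in_time d F) &
      forall phi, local_flow U X phi -> forall x, U x ->
        \forall t \near (0 : C), phi t x = poly_in_time d F t x].

(* The orbit through x is the whole leaf of X, not only the image of the local
   flow.  As the time is complex, continuing a solution along a loop may lead
   to another value, so the leaf need not be the image of a single integral
   curve defined on a domain of C: points are joined by finite chains. *)
Inductive flow_orbit U X (x : V) : V -> Prop :=
| flow_orbit_refl : flow_orbit U X x x
| flow_orbit_step (D : set C) (gamma : C -> V) (s t : C) :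
    open D -> connected D -> D s -> D t ->
    (forall u, D u -> U (gamma u) /\
       is_derive u (1 : C) gamma (X (gamma u))) ->
    flow_orbit U X x (gamma s) -> flow_orbit U X x (gamma t).

End Flows.

Section RationalCurves.
Variables (R : realType) (n : nat).
Local Notation C := (R[i]^o).
Local Notation V := ('rV[C]_n).
Implicit Types S T Z : set V.

Definition zero_locus (I : set (mpoly.mpoly n C)) : set V :=
  [set x | forall f, I f -> mpoly.meval (fun i => x 0 i) f = 0].

Definition algebraic_set S := exists I, S = zero_locus I.

Definition irreducible_algebraic S :=
  [/\ algebraic_set S, S !=set0 &
      forall T1 T2, algebraic_set T1 -> algebraic_set T2 ->
        S = T1 `|` T2 -> S = T1 \/ S = T2].

(* Krull dimension one. *)
Definition irreducible_curve S :=
  [/\ irreducible_algebraic S,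
      exists2 Z, irreducible_algebraic Z & Z `<` S &
      forall Z1 Z2, irreducible_algebraic Z1 -> irreducible_algebraic Z2 ->
        Z1 `<` Z2 -> ~ Z2 `<` S].

Definition zariski_closure S : set V :=
  \bigcap_(T in [set T | algebraic_set T /\ S `<=` T]) T.

(* The image of the rational map t |-> (num_i(t) / den_i(t))_i, poles
   excluded. *)
Definition rational_image (num den : 'I_n -> {poly C}) : set V :=
  [set x | exists2 t : C, (forall i, (den i).[t] != 0) &
             x = \row_i ((num i).[t] / (den i).[t])].

(* A rational parametrization may miss points of the curve, e.g. (-1, 0)
   for ((1 - t^2)/(1 + t^2), 2t/(1 + t^2)) on x^2 + y^2 = 1; it is only required
   to be dominant. *)
Definition rational_curve S :=
  irreducible_curve S /\
  exists num den : 'I_n -> {poly C},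
    (forall i, den i != 0) /\ S = zariski_closure (rational_image num den).

End RationalCurves.

(* Main.v *)
Require Import Defs.
From HB Require Import structures.
From mathcomp Require Import all_boot all_order all_algebra complex.
From mathcomp Require Import all_classical all_reals all_analysis.
From mathcomp Require Import ring lra.
From mathcomp Require mpoly.

(* Put G_0 = id and G_(j+1)(x) = dG_j(x)(X(x)); along any solution of u' = X(u)
   the j-th derivative of u is G_j(u).  Differentiating the barycentric identity
   j - 1 times at t = 0 gives (sum_k a_k^j) G_j = 0 for all j >= 1.  Evaluating
   prod_k (Y - a_k) at the a_k shows that the power sums for 1 <= j <= p cannot
   all vanish, the a_k being nonzero; hence G_p = 0 on U, and every solution
   coincides with its Taylor polynomial of degree < p.

   The G_j are holomorphic because the differential of a holomorphic map is
   again holomorphic.  This rests on Cauchy's estimate for the derivative, which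
   comes from Goursat's bisection argument.  Contour integrals are replaced by
   their trapezoidal sums on dyadic subdivisions: these are additive and, over
   closed polygons, vanish for affine functions, which is all that is needed.

   Following solutions along a connected domain only shifts the time parameter
   of the polynomial curve, so an orbit lies in the image of one polynomial
   curve.  If some coordinate u of that curve is not constant, then C[t] is
   integral over C[u]; on a proper irreducible closed subset of the Zariski
   closure of the curve every coordinate therefore takes finitely many values,
   so it is constant by irreducibility. *)

Set Implicit Arguments.
Unset Strict Implicit.
Unset Printing Implicit Defensive.

Import Order.TTheory GRing.Theory Num.Theory.
Import numFieldNormedType.Exports.

Local Open Scope classical_set_scope.
Local Open Scope ring_scope.
Local Open Scope complex_scope.

(** * Norms with real values *)

Section ComplexNorm.
Variable R : realType.
Local Notation C := (R[i]^o).
Implicit Types V W : normedModType R[i].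

(* Norms over R[i] take values in R[i]; the real part makes lra applicable. *)
Definition nrm W (x : W) : R := complex.Re `|x|.

Lemma nrmE W (x : W) : `|x| = (nrm x)%:C.
Proof. by rewrite /nrm RRe_real // ger0_real. Qed.

Lemma nrm_ge0 W (x : W) : 0 <= nrm x.
Proof. by rewrite -ler0c -nrmE. Qed.

Lemma nrmD W (x y : W) : nrm (x + y) <= nrm x + nrm y.
Proof. by rewrite -lecR rmorphD /= -!nrmE ler_normD. Qed.

Lemma nrmN W (x : W) : nrm (- x) = nrm x.
Proof. by rewrite /nrm normrN. Qed.

Lemma nrm_distC W (x y : W) : nrm (x - y) = nrm (y - x).
Proof. by rewrite -nrmN opprB. Qed.

Lemma nrmZ W (k : C) (x : W) : nrm (k *: x) = nrm k * nrm x.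
Proof. by apply: complexI; rewrite rmorphM /= -!nrmE normrZ. Qed.

Lemma nrmM (k l : C) : nrm (k * l) = nrm k * nrm l.
Proof. by rewrite -nrmZ. Qed.

Lemma nrm0 W : nrm (0 : W) = 0.
Proof. by rewrite /nrm normr0. Qed.

Lemma nrm1 : nrm (1 : C) = 1.
Proof. by apply: complexI; rewrite -nrmE normr1. Qed.

Lemma nrm_eq0 W (x : W) : (nrm x == 0) = (x == 0).
Proof. by rewrite -(inj_eq (@complexI R)) -nrmE normr_eq0. Qed.

Lemma nrm_gt0 W (x : W) : (0 < nrm x) = (x != 0).
Proof. by rewrite lt_def nrm_ge0 nrm_eq0 andbT. Qed.

Lemma nrmV (k : C) : nrm k^-1 = (nrm k)^-1.
Proof. by apply: complexI; rewrite fmorphV /= -!nrmE normfV. Qed.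

Lemma nrmX (k : C) n : nrm (k ^+ n) = nrm k ^+ n.
Proof. by elim: n => [|n IH]; rewrite ?expr0 ?nrm1 // !exprS nrmM IH. Qed.

Lemma nrmR (x : R) : nrm (x%:C : C) = `|x|.
Proof. by rewrite /nrm normc_def /= expr0n addr0 sqrtr_sqr. Qed.

Lemma nrm_distD W (y x z : W) : nrm (x - z) <= nrm (x - y) + nrm (y - z).
Proof. by apply: le_trans (nrmD _ _); rewrite addrA subrK. Qed.

Lemma nrmB W (x y : W) : nrm (x - y) <= nrm x + nrm y.
Proof. by apply: le_trans (nrmD _ _) _; rewrite nrmN. Qed.

Lemma nrm_le_dist W (x y : W) : nrm x <= nrm y + nrm (x - y).
Proof. by apply: le_trans (nrmD _ _); rewrite addrC subrK. Qed.

Lemma nrm_sum W (I : Type) (r : seq I) (P : pred I) (F : I -> W) :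
  nrm (\sum_(i <- r | P i) F i) <= \sum_(i <- r | P i) nrm (F i).
Proof.
elim/big_ind2: _ => [|x1 x2 y1 y2 h1 h2|//]; first by rewrite nrm0.
by apply: le_trans (nrmD _ _) _; apply: lerD.
Qed.

Lemma ball_nrm W (x y : W) (e : R) : ball x e%:C y = (nrm (x - y) < e).
Proof. by rewrite -ball_normE /ball_ /= nrmE ltcR. Qed.

Lemma nbhs_nrmP W (x : W) (P : set W) :
  nbhs x P <-> exists2 e : R, 0 < e & forall y, nrm (y - x) < e -> P y.
Proof.
split=> [/nbhs_ballP[e /= e0 sub]|[e e0 sub]].
  have er : e = (complex.Re e)%:C by rewrite RRe_real // gtr0_real.
  exists (complex.Re e); first by rewrite -ltcR -er.
  by move=> y yx; apply: sub; rewrite er ball_nrm nrm_distC.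
apply/nbhs_ballP; exists e%:C; first by rewrite /= ltcR.
by move=> y; rewrite ball_nrm nrm_distC => /sub.
Qed.

(** Uniqueness of the differential identifies it with [L0], which enters as a plain function because
    some candidates arise below as pointwise limits. *)
Lemma diff_nrmP V W (f : V -> W) (x : V) (L0 : V -> W) :
  linear L0 -> continuous L0 ->
  (forall e : R, 0 < e -> exists2 d : R, 0 < d & forall h, nrm h < d ->
     nrm (f (x + h) - f x - L0 h) <= e * nrm h) ->
  differentiable f x /\ 'd f x = L0 :> (V -> W).
Proof.
move=> lL cL H.
pose L : {linear V -> W} := HB.pack L0 (GRing.isLinear.Build _ _ _ _ L0 lL).
have E : f \o shift x = cst (f x) + L +o_ (0 : V) id.
  apply/eqaddoP => _/posnumP[e].
  have ee : e%:num = (complex.Re e%:num)%:C.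
    by rewrite RRe_real // gtr0_real.
  have e0 : 0 < complex.Re e%:num by rewrite -ltcR -ee; exact: gt0.
  have [d d0 Hd] := H _ e0.
  apply/nbhs_nrmP; exists d => // h; rewrite subr0 => /Hd.
  rewrite !nrmE ee -rmorphM lecR; apply: le_trans.
  by rewrite /= !fctE /= opprD addrA [h + x]addrC.
have DE := @diff_unique _ V W f L x cL E; split => //.
by apply/diff_locallyP; rewrite DE.
Qed.

Lemma diff_nrm V W (f : V -> W) (x : V) : differentiable f x ->
  forall e : R, 0 < e -> exists2 d : R, 0 < d & forall h, nrm h < d ->
     nrm (f (x + h) - f x - 'd f x h) <= e * nrm h.
Proof.
move=> /diff_locallyP[_ /eqaddoP E] e e0.
have e0' : 0 < e%:C by rewrite ltcR.
have /nbhs_nrmP[d d0 Hd] := E _ e0'.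
exists d => // h hd; have := Hd h; rewrite subr0 => /(_ hd).
by rewrite /= !fctE !nrmE -rmorphM lecR opprD addrA [h + x]addrC.
Qed.

Lemma nrm_Re (z : C) : `|complex.Re z| <= nrm z.
Proof.
rewrite /nrm normc_def /= -sqrtr_sqr ler_sqrt ?addr_ge0 ?sqr_ge0 //.
by rewrite lerDl sqr_ge0.
Qed.

Lemma nrm_Im (z : C) : `|complex.Im z| <= nrm z.
Proof.
rewrite /nrm normc_def /= -sqrtr_sqr ler_sqrt ?addr_ge0 ?sqr_ge0 //.
by rewrite lerDr sqr_ge0.
Qed.

Lemma nrm_ReIm (z : C) : nrm z <= `|complex.Re z| + `|complex.Im z|.
Proof.
rewrite [X in nrm X]complexE; apply: le_trans (nrmD _ _) _.
rewrite nrmM !nrmR lerD2l.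
by rewrite /nrm normc_def /= expr0n add0r expr1n sqrtr1 mul1r.
Qed.

End ComplexNorm.

(** * Cauchy's estimate *)

Section Nested.
Variable R : realType.
Local Notation C := (R[i]^o).

(** The intervals of radius [2 * (d / 2 ^+ n)] around [a n] are nested, and the supremum of their
    left ends lies in all of them. *)
Lemma cvg_dyadic_real (a : nat -> R) (d : R) :
  (forall n, `|a n.+1 - a n| <= d / 2 ^+ n) ->
  exists z, forall n, `|a n - z| <= 2 * (d / 2 ^+ n).
Proof.
move=> H; set q := fun n => d / 2 ^+ n.
have qS n : q n.+1 = q n / 2 by rewrite /q exprS invfM mulrCA mulrC.
have Hq n : - q n <= a n.+1 - a n <= q n by rewrite -ler_norml H.
have lb n k : a n - 2 * q n <= a (n + k)%N - 2 * q (n + k)%N.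
  elim: k => [|k IH]; first by rewrite addn0.
  by rewrite addnS qS; have /andP[h1 h2] := Hq (n + k)%N; lra.
have ub n k : a (n + k)%N + 2 * q (n + k)%N <= a n + 2 * q n.
  elim: k => [|k IH]; first by rewrite addn0.
  by rewrite addnS qS; have /andP[h1 h2] := Hq (n + k)%N; lra.
have q0 n : 0 <= q n by have /andP[h1 h2] := Hq n; lra.
have bd n m : a n - 2 * q n <= a m + 2 * q m.
  have := lb n m; have := ub m n; rewrite addnC.
  by have := q0 (n + m)%N; lra.
pose S := [set a n - 2 * q n | n in setT].
have S0 : S !=set0 by exists (a 0%N - 2 * q 0%N), 0%N.
have Sub m : ubound S (a m + 2 * q m) by move=> _ [n _ <-]; exact: bd.
exists (sup S) => n; rewrite ler_norml -/(q n); apply/andP; split.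
  have := ge_sup S0 (Sub n). lra.
have : a n - 2 * q n <= sup S.
  by apply: ub_le_sup; [exists (a 0%N + 2 * q 0%N); exact: Sub | exists n].
lra.
Qed.

Lemma cvg_dyadic (a : nat -> C) (d : R) :
  (forall n, nrm (a n.+1 - a n) <= d / 2 ^+ n) ->
  exists z, forall n, nrm (a n - z) <= 4 * (d / 2 ^+ n).
Proof.
move=> H.
have [n|x Hx] := @cvg_dyadic_real (fun n => complex.Re (a n)) d.
  by rewrite -raddfB; apply: le_trans (nrm_Re _) (H n).
have [n|y Hy] := @cvg_dyadic_real (fun n => complex.Im (a n)) d.
  by rewrite -raddfB; apply: le_trans (nrm_Im _) (H n).
exists (x +i* y) => n; apply: le_trans (nrm_ReIm _) _.
rewrite !raddfB /=; have := Hx n; have := Hy n; lra.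
Qed.

(** The common engine of the bisection arguments: dependent choice iterates the refinement step, and
    the marked points [p t] converge geometrically. *)
Lemma nested_limit (T : Type) (p : T -> C) (Inv : nat -> T -> Prop) (d : R) t0 :
  Inv 0%N t0 ->
  (forall n t, Inv n t ->
     exists2 t', Inv n.+1 t' & nrm (p t' - p t) <= d / 2 ^+ n) ->
  exists z, forall n, exists2 t, Inv n t & nrm (p t - z) <= 4 * (d / 2 ^+ n).
Proof.
move=> I0 step.
have /choice[f Hf] : forall x : nat * T, exists t', Inv x.1 x.2 ->
    Inv x.1.+1 t' /\ nrm (p t' - p x.2) <= d / 2 ^+ x.1.
  move=> [n t] /=.
  have [/step[t' h1 h2]|nI] := pselect (Inv n t); first by exists t'.
  by exists t => /nI.
pose s := fix s n := if n is k.+1 then f (k, s k) else t0.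
have Is n : Inv n (s n).
  by elim: n => [//|n IH] /=; have [] := Hf (n, s n) IH.
have [n|z Hz] := @cvg_dyadic (fun n => p (s n)) d.
  by have [_] := Hf (n, s n) (Is n).
by exists z => n; exists (s n).
Qed.

Lemma dyadic_small (x e : R) : 0 < e -> exists n, x / 2 ^+ n < e.
Proof.
move=> e0; have [n /ltW xn] : exists n, `|x| / e < n%:R.
  exists (Num.bound (`|x| / e)); apply: archi_boundP.
  by rewrite divr_ge0 // ltW.
exists n; rewrite ltr_pdivrMr ?exprn_gt0 //.
apply: le_lt_trans (ler_norm x) _; rewrite mulrC -ltr_pdivrMr //.
apply: le_lt_trans xn _; rewrite -natrX ltr_nat; exact: ltn_expl.
Qed.

End Nested.

(** * Goursat's theorem for trapezoidal sums *)

Section Goursat.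
Variable R : realType.
Local Notation C := (R[i]^o).
Variable W : normedModType R[i].
Implicit Types (g : C -> W) (a b c z : C) (D : set C) (m : nat).

Definition mid a b : C := (a + b) / 2.

Definition nrm_closed D := forall z,
  (forall d : R, 0 < d -> exists2 y, D y & nrm (y - z) < d) -> D z.

(** Bisection only produces midpoints, so this property, with [nrm_closed] for the limit point,
    stands in for closed convexity. *)
Definition midconvex D := forall a b, D a -> D b -> D (mid a b).

(* The trapezoidal sum for the integral of g over the segment from a to b, cut
   into 2 ^ m equal parts. *)
Fixpoint segsum g m a b : W :=
  if m is k.+1 then segsum g k a (mid a b) + segsum g k (mid a b) b
  else ((b - a) / 2) *: (g a + g b).

Definition trisum g m a b c :=
  segsum g m a b + segsum g m b c + segsum g m c a.

Lemma midC a b : mid a b = mid b a.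
Proof. by rewrite /mid addrC. Qed.

Lemma mid_subl a b : mid a b - a = (b - a) / 2.
Proof. by rewrite /mid; field. Qed.

Lemma mid_subr a b : b - mid a b = (b - a) / 2.
Proof. by rewrite /mid; field. Qed.

Lemma nrm_half (z : C) : nrm (z / 2) = nrm z / 2.
Proof. by rewrite nrmM nrmV -(rmorph_nat (real_complex R)) nrmR normr_nat. Qed.

Lemma segsum_rev g m a b : segsum g m b a = - segsum g m a b.
Proof.
elim: m a b => [|m IH] a b /=.
  by rewrite -scaleNr -mulNr opprB [g a + g b]addrC.
by rewrite midC IH (IH a) opprD addrC.
Qed.

Lemma segsumD g h m a b :
  segsum (fun z => g z + h z) m a b = segsum g m a b + segsum h m a b.
Proof.
elim: m a b => [|m IH] a b /=; first by rewrite -scalerDr addrACA.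
by rewrite !IH addrACA.
Qed.

Lemma segsumN g m a b : segsum (fun z => - g z) m a b = - segsum g m a b.
Proof.
elim: m a b => [|m IH] a b /=; first by rewrite -scalerN opprD.
by rewrite !IH opprD.
Qed.

Lemma segsum_affine (u v : W) m a b :
  segsum (fun z => u + z *: v) m a b = (b - a) *: (u + mid a b *: v).
Proof.
elim: m a b => [|m IH] a b /=.
  have -> : u + a *: v + (u + b *: v) = (2 : C) *: u + (a + b) *: v.
    by rewrite addrACA -scalerDl scaler_nat mulr2n.
  rewrite !scalerDr !scalerA.
  by rewrite /mid; congr (_ *: _ + _ *: _); field.
rewrite !IH /mid !scalerDr !scalerA addrACA -!scalerDl.
by congr (_ *: _ + _ *: _); field.
Qed.

(** The trapezoidal rule is exact on affine functions, so each side gives the increment of the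
    quadratic primitive [P], and these telescope around the triangle. *)
Lemma trisum_affine (u v : W) m a b c :
  trisum (fun z => u + z *: v) m a b c = 0.
Proof.
pose P z := z *: u + (z ^+ 2 / 2) *: v.
have E x y : segsum (fun z => u + z *: v) m x y = P y - P x.
  rewrite segsum_affine /P opprD addrACA -2!scalerBl scalerDr scalerA.
  by congr (_ + _ *: _); rewrite /mid; field.
by rewrite /trisum !E; move: P {E} => P; rewrite [P b - _ + (_ - _)]addrC !addrA !subrK subrr.
Qed.

Lemma segsum_le D g (M : R) m a b : midconvex D ->
  (forall z, D z -> nrm (g z) <= M) -> D a -> D b ->
  nrm (segsum g m a b) <= M * nrm (b - a).
Proof.
move=> cD gM; elim: m a b => [|m IH] a b Da Db /=.
  rewrite nrmZ nrm_half.
  have h : nrm (g a + g b) <= M + M.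
    by apply: le_trans (nrmD _ _) _; apply: lerD; exact: gM.
  have := ler_wpM2l (nrm_ge0 (b - a)) h; lra.
have Dm := cD _ _ Da Db.
apply: le_trans (nrmD _ _) _.
have := IH _ _ Da Dm; have := IH _ _ Dm Db.
rewrite mid_subl mid_subr nrm_half; lra.
Qed.

Lemma trisum_le D g (M d : R) m a b c : midconvex D ->
  (forall z, D z -> nrm (g z) <= M) -> D a -> D b -> D c ->
  nrm (b - a) <= d -> nrm (c - b) <= d -> nrm (a - c) <= d ->
  nrm (trisum g m a b c) <= 3 * M * d.
Proof.
move=> cD gM Da Db Dc h1 h2 h3.
have M0 : 0 <= M by apply: le_trans (gM _ Da); exact: nrm_ge0.
have k1 := segsum_le m cD gM Da Db; have k2 := segsum_le m cD gM Db Dc.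
have k3 := segsum_le m cD gM Dc Da.
have := ler_wpM2l M0 h1; have := ler_wpM2l M0 h2; have := ler_wpM2l M0 h3.
rewrite /trisum => *; apply: le_trans (nrmD _ _) _.
have := nrmD (segsum g m a b) (segsum g m b c); lra.
Qed.

Lemma trisumB g h m a b c :
  trisum (fun z => g z - h z) m a b c = trisum g m a b c - trisum h m a b c.
Proof.
rewrite /trisum !segsumD !segsumN !opprD.
by rewrite [LHS](AC (2*2*2) (1*3*5*(2*4*6)))%AC.
Qed.

(** One more bisection of the sides is mesh [m] on the half sides. The sides of the middle triangle
    are each traversed in both directions and cancel. *)
Lemma trisumS g m a b c :
  trisum g m.+1 a b c =
    trisum g m a (mid a b) (mid c a) + trisum g m (mid a b) b (mid b c) +
    trisum g m (mid c a) (mid b c) c + trisum g m (mid a b) (mid b c) (mid c a).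
Proof.
rewrite /trisum /=.
rewrite (segsum_rev _ _ (mid c a) (mid a b)) (segsum_rev _ _ (mid a b) (mid b c)).
rewrite (segsum_rev _ _ (mid b c) (mid c a)).
set x1 := segsum g m a _; set x2 := segsum g m _ b.
set x3 := segsum g m b _; set x4 := segsum g m _ c.
set x5 := segsum g m c _; set x6 := segsum g m _ a.
set y1 := segsum g m _ _; set y2 := segsum g m _ _; set y3 := segsum g m _ _.
rewrite [RHS](AC (3*3*3*3) (1*4*(5*8)*(9*3)*(12*2)*(10*6)*(11*7)))%AC.
by rewrite /= !subrr !addr0.
Qed.

Lemma is_derive_nrmP g z (l : W) : is_derive z (1 : C) g l <->
  forall e : R, 0 < e -> exists2 d : R, 0 < d & forall h, nrm h < d ->
    nrm (g (z + h) - g z - h *: l) <= e * nrm h.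
Proof.
split=> [[dg <-] e e0|H].
  have /derivable1_diffP dfg := dg.
  have [d d0 Hd] := diff_nrm dfg e0; exists d => // h /Hd.
  suff -> : 'd g z h = h *: 'D_1 g z by [].
  by rewrite deriveE // -linearZ /= [h *: _]mulr1.
have [|||dg Dg] := @diff_nrmP _ _ _ g z ( *:%R^~ l).
- by move=> u y w; rewrite scalerDl scalerA.
- exact: scalel_continuous.
- exact: H.
apply: DeriveDef; first exact/derivable1_diffP.
by rewrite deriveE // Dg /= scale1r.
Qed.

(* A triangle violating the bound has a quarter violating the bound divided by
   four, whereas near the limit of such triangles g is affine up to o(diameter),
   uniformly in the mesh m. *)
Lemma goursat D g (g' : C -> W) a b c (e : R) : midconvex D -> nrm_closed D ->
  (forall z, D z -> is_derive z (1 : C) g (g' z)) ->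
  D a -> D b -> D c -> 0 < e ->
  exists m0, forall m, (m0 <= m)%N -> nrm (trisum g m a b c) <= e.
Proof.
move=> cD clD dg Da Db Dc e0.
pose P (t : C * C * C) e := exists m0, forall m, (m0 <= m)%N ->
  nrm (trisum g m t.1.1 t.1.2 t.2) <= e.
apply: contrapT => nP.
pose d := nrm (b - a) + nrm (c - b) + nrm (a - c).
have [n1 n2 n3] := And3 (nrm_ge0 (b - a)) (nrm_ge0 (c - b)) (nrm_ge0 (a - c)).
(* At depth [n] the sides have shrunk by [2 ^+ n] while the bound [e / 4 ^+ n] still fails for
   arbitrarily fine meshes. *)
pose Inv n (t : C * C * C) := [/\ D t.1.1, D t.1.2 & D t.2] /\
  [/\ nrm (t.1.2 - t.1.1) <= d / 2 ^+ n, nrm (t.2 - t.1.2) <= d / 2 ^+ n &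
     nrm (t.1.1 - t.2) <= d / 2 ^+ n] /\ ~ P t (e / 4 ^+ n).
have I0 : Inv 0%N (a, b, c).
  by split=> //=; rewrite expr0 !divr1; split => //; split; rewrite /d; lra.
have [n [[x y] w] [[/= Dx Dy Dw] [[h1 h2 h3] nPt]]|z Hz] :=
    @nested_limit R _ (fun t => t.1.1) Inv d _ I0.
  have Dxy := cD _ _ Dx Dy; have Dyw := cD _ _ Dy Dw; have Dwx := cD _ _ Dw Dx.
  set q := d / 2 ^+ n in h1 h2 h3 *.
  have qS : d / 2 ^+ n.+1 = q / 2 by rewrite /q exprS invfM mulrCA mulrC.
  have eS : e / 4 ^+ n.+1 = e / 4 ^+ n / 4 by rewrite exprS invfM mulrCA mulrC.
  have [l1 l2 l3] : [/\ nrm (mid x y - x) <= q / 2, nrm (mid y w - y) <= q / 2 &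
      nrm (mid w x - w) <= q / 2] by rewrite !mid_subl !nrm_half; split; lra.
  have [r1 r2 r3] : [/\ nrm (y - mid x y) <= q / 2, nrm (w - mid y w) <= q / 2 &
      nrm (x - mid w x) <= q / 2] by rewrite !mid_subr !nrm_half; split; lra.
  have m1 : nrm (mid w x - mid x y) <= q / 2.
    by rewrite (_ : _ - _ = (w - y) / 2) ?nrm_half; [lra | rewrite /mid; field].
  have m2 : nrm (mid x y - mid y w) <= q / 2.
    by rewrite (_ : _ - _ = (x - w) / 2) ?nrm_half; [lra | rewrite /mid; field].
  have m3 : nrm (mid y w - mid w x) <= q / 2.
    by rewrite (_ : _ - _ = (y - x) / 2) ?nrm_half; [lra | rewrite /mid; field].
  have q0 : 0 <= q by apply: le_trans h1; exact: nrm_ge0.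
  have near0 v : nrm (v - x) <= q / 2 -> nrm (v - x) <= q by lra.
  have [p1|p1] := pselect (P (x, mid x y, mid w x) (e / 4 ^+ n.+1)); last first.
    exists (x, mid x y, mid w x); last by rewrite /= subrr nrm0.
    by do ![split]; rewrite //= qS.
  have [p2|p2] := pselect (P (mid x y, y, mid y w) (e / 4 ^+ n.+1)); last first.
    exists (mid x y, y, mid y w); last exact: near0.
    by do ![split]; rewrite //= qS.
  have [p3|p3] := pselect (P (mid w x, mid y w, w) (e / 4 ^+ n.+1)); last first.
    exists (mid w x, mid y w, w); last by apply: near0; rewrite nrm_distC.
    by do ![split]; rewrite //= qS.
  have [p4|p4] := pselect (P (mid x y, mid y w, mid w x) (e / 4 ^+ n.+1)); last first.
    exists (mid x y, mid y w, mid w x); last exact: near0.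
    by do ![split]; rewrite //= qS nrm_distC.
  case: nPt; move: p1 p2 p3 p4 => [b1 H1] [b2 H2] [b3 H3] [b4 H4].
  (* The successor accounts for [trisumS]: mesh [m.+1] on the triangle is mesh [m] on its
     quarters. *)
  exists (maxn (maxn b1 b2) (maxn b3 b4)).+1 => -[//|m]; rewrite ltnS !geq_max.
  move=> /andP[/andP[/H1 k1 /H2 k2] /andP[/H3 k3 /H4 k4]] /=.
  rewrite trisumS; apply: le_trans (nrmD _ _) _.
  apply: le_trans (lerD (nrmD _ _) (lexx _)) _.
  apply: le_trans (lerD (lerD (nrmD _ _) (lexx _)) (lexx _)) _.
  by rewrite eS /= in k1 k2 k3 k4; lra.
have Dz : D z.
  apply: clD => r r0; have [n Hn] := @dyadic_small R (4 * d) r r0.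
  have [t [[Dt _ _] _] nt] := Hz n; exists t.1.1 => //.
  by apply: le_lt_trans nt _; rewrite mulrA.
have d0 : 0 <= d by rewrite /d; lra.
(* The final estimate is [15 * eta * d ^+ 2 / 4 ^+ n], which this choice keeps below [e / 4 ^+ n];
   the added 1 covers [d = 0]. *)
pose eta := e / (16 * (d ^+ 2 + 1)).
have eta0 : 0 < eta by rewrite divr_gt0 // mulr_gt0 // ltr_wpDl // sqr_ge0.
have /is_derive_nrmP/(_ _ eta0)[r r0 Hr] := dg _ Dz.
have [n Hn] := @dyadic_small R (5 * d) r r0.
have [[[x y] w] [[/= Dx Dy Dw] [[h1 h2 h3] nPt]] xz] := Hz n; case: nPt.
set q := d / 2 ^+ n in h1 h2 h3 xz *.
have q0 : 0 <= q by apply: le_trans h1; exact: nrm_ge0.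
(* The first vertex is within [4 * q] of [z] and the other two within [q] of the first. *)
pose B := [set v : C | nrm (v - z) <= 5 * q].
have cB : midconvex B.
  move=> u v; rewrite /B /= => Bu Bv.
  rewrite (_ : _ - _ = ((u - z) + (v - z)) / 2); last by rewrite /mid; field.
  by rewrite nrm_half; have := nrmD (u - z) (v - z); lra.
(* The first order expansion of [g] at [z]; being affine, it has zero sum over the triangle. *)
pose A v := (g z - z *: g' z) + v *: g' z.
have gA v : B v -> nrm (g v - A v) <= eta * (5 * q).
  move=> Bv; have := Hr (v - z); rewrite addrCA subrr addr0.
  rewrite (_ : g v - A v = g v - g z - (v - z) *: g' z); last first.
    by rewrite /A scalerBl opprB !opprD opprK !addrA addrAC.
  move=> H; apply: le_trans (H _) _; last by rewrite ler_wpM2l // ltW.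
  by apply: le_lt_trans Bv _; rewrite /q mulrA.
exists 0%N => m _ /=.
have -> : trisum g m x y w = trisum (fun v => g v - A v) m x y w.
  by rewrite trisumB trisum_affine subr0.
have Bx : B x by rewrite /B /=; lra.
have Bw : B w by rewrite /B /=; have := nrm_distD x w z; rewrite (nrm_distC w x); lra.
have By : B y by rewrite /B /=; have := nrm_distD x y z; lra.
apply: le_trans (trisum_le m cB gA Bx By Bw h1 h2 h3) _.
have qq : q * q = d ^+ 2 * (4 ^+ n)^-1.
  by rewrite /q mulrACA -expr2 -invfM -exprMn -natrM.
have eE : e = eta * (16 * (d ^+ 2 + 1)).
  by rewrite /eta divfK // gt_eqF // mulr_gt0 // ltr_wpDl // sqr_ge0.
have t0 : 0 <= (4 ^+ n : R)^-1 by rewrite invr_ge0 exprn_ge0.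
have k1 := mulr_ge0 (mulr_ge0 (ltW eta0) (sqr_ge0 d)) t0.
have k2 := mulr_ge0 (ltW eta0) t0.
rewrite (_ : 3 * _ * q = 15 * (eta * (q * q))); last by ring.
by rewrite qq [in leRHS]eE; lra.
Qed.

End Goursat.

(** * The mean value inequality and further properties of segment sums *)

Section CauchyEstimate.
Variable R : realType.
Local Notation C := (R[i]^o).

(** If the increment of [f] exceeded the bound by [e], one half of the segment would carry at least
    half of that increment, and so on. At the limit point, differentiability bounds the increments
    over short segments too well for this. *)
Lemma mean_value_le (W : normedModType R[i]) (D : set C) (f f' : C -> W) (M : R) a b :
  midconvex D -> nrm_closed D ->
  (forall z, D z -> is_derive z (1 : C) f (f' z)) ->
  (forall z, D z -> nrm (f' z) <= M) ->
  D a -> D b -> nrm (f b - f a) <= M * nrm (b - a).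
Proof.
move=> cD clD df fM Da Db; rewrite leNgt; apply/negP => lt.
set l := nrm (b - a) in lt.
pose e := nrm (f b - f a) - M * l.
have e0 : 0 < e by rewrite subr_gt0.
have l0 : 0 <= l by exact: nrm_ge0.
pose Inv n (t : C * C) := [/\ D t.1, D t.2, nrm (t.2 - t.1) = l / 2 ^+ n &
  (M * l + e) / 2 ^+ n <= nrm (f t.2 - f t.1)].
have I0 : Inv 0%N (a, b) by split => //=; rewrite expr0 divr1 // /e addrC subrK.
have [n [x y] /= [/= Dx Dy hl hf]|z Hz] := @nested_limit R _ fst Inv l _ I0.
  have Dm := cD _ _ Dx Dy.
  have tS t : t / 2 ^+ n.+1 = t / 2 ^+ n / 2 :> R.
    by rewrite exprS invfM mulrCA mulrC.
  have l2 : 0 <= l / 2 ^+ n by rewrite -hl nrm_ge0.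
  have [h|h] := leP ((M * l + e) / 2 ^+ n.+1) (nrm (f (mid x y) - f x)).
    exists (x, mid x y); last by rewrite /= subrr nrm0.
    by split => //=; rewrite mid_subl nrm_half hl tS.
  exists (mid x y, y); last by rewrite /= mid_subl nrm_half hl; lra.
  split => //=; first by rewrite mid_subr nrm_half hl tS.
  rewrite tS in h *; have := nrm_distD (f (mid x y)) (f y) (f x); lra.
have Dz : D z.
  apply: clD => r r0; have [n Hn] := @dyadic_small R (4 * l) r r0.
  have [t [Dt _ _ _] nt] := Hz n; exists t.1 => //.
  by apply: le_lt_trans nt _; rewrite mulrA.
(* The ends lie within [4 * q] and [5 * q] of [z], so the errors add up to [9 * eta * q], and
   [9 * eta * l < e]. *)
pose eta := e / (10 * (l + 1)).
have eta0 : 0 < eta by rewrite divr_gt0 // mulr_gt0 // ltr_wpDl.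
have /is_derive_nrmP/(_ _ eta0)[r r0 Hr] := df _ Dz.
have [n Hn] := @dyadic_small R (5 * l) r r0.
have [[x y] [/= Dx Dy hl hf] xz] := Hz n.
set q := l / 2 ^+ n in hl xz.
have q0 : 0 <= q by rewrite -hl nrm_ge0.
have qr : 5 * q < r by rewrite /q mulrA.
have yz : nrm (y - z) <= 5 * q by have := nrm_distD x y z; lra.
have Hx : nrm (f x - f z - (x - z) *: f' z) <= eta * nrm (x - z).
  by have := Hr (x - z); rewrite addrCA subrr addr0; apply; lra.
have Hy : nrm (f y - f z - (y - z) *: f' z) <= eta * nrm (y - z).
  by have := Hr (y - z); rewrite addrCA subrr addr0; apply; lra.
have E : f y - f x = (f y - f z - (y - z) *: f' z) - (f x - f z - (x - z) *: f' z)
   + (y - x) *: f' z.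
  have -> : (y - x) *: f' z = (y - z) *: f' z - (x - z) *: f' z.
    by rewrite -scalerBl; congr (_ *: _); ring.
  move: (_ *: _) (_ *: _) => u v.
  rewrite !opprD !opprK [RHS](AC (3*3*2) (1*4*(2*5)*(3*7)*(6*8)))%AC.
  by rewrite /= !addNr subrr !addr0.
have h1 := nrmB (f y - f z - (y - z) *: f' z) (f x - f z - (x - z) *: f' z).
have h2 : nrm (f y - f x) <= eta * (5 * q) + eta * (4 * q) + q * M.
  rewrite E; apply: le_trans (nrmD _ _) _; rewrite nrmZ hl.
  have k1 := ler_wpM2l q0 (fM _ Dz).
  have k2 := ler_wpM2l (ltW eta0) xz; have k3 := ler_wpM2l (ltW eta0) yz; lra.
have t0 : 0 < (2 ^+ n : R)^-1 by rewrite invr_gt0 exprn_gt0.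
have eE : e = eta * (10 * (l + 1)).
  by rewrite /eta divfK // gt_eqF // mulr_gt0 // ltr_wpDl.
have : (M * l + e) / 2 ^+ n <= (9 * eta * l + M * l) / 2 ^+ n.
  apply: le_trans hf _; apply: le_trans h2 _; rewrite /q; lra.
rewrite ler_pM2r // eE; have := mulr_ge0 (ltW eta0) l0; lra.
Qed.

Lemma segsumZ (k : C) (g : C -> C) m (a b : C) :
  segsum (fun z => k * g z) m a b = k * segsum g m a b.
Proof.
elim: m a b => [|m IH] a b /=; last by rewrite !IH mulrDr.
by rewrite -mulrDr /GRing.scale /= mulrCA.
Qed.

Lemma segsum_scale (k : C) (g : C -> C) m (a b : C) :
  segsum g m (k * a) (k * b) = k * segsum (fun z => g (k * z)) m a b.
Proof.
have midM x y : mid (k * x) (k * y) = k * mid x y by rewrite /mid -mulrDr mulrA.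
elim: m a b => [|m IH] a b /=; last by rewrite midM !IH mulrDr.
by rewrite /GRing.scale /= -mulrBr !mulrA.
Qed.

Lemma eq_segsum (W : normedModType R[i]) (g h : C -> W) m (a b : C) : g =1 h ->
  segsum g m a b = segsum h m a b.
Proof. by move=> gh; elim: m a b => [|m IH] a b /=; rewrite ?gh // !IH. Qed.

Lemma Im_half (x y : C) : complex.Im (x / 2 * y) = complex.Im (x * y) / 2.
Proof.
have -> : x / 2 * y = (2^-1 : R)%:C * (x * y).
  by rewrite fmorphV rmorph_nat; field.
by case: (x * y) => u v /=; rewrite mul0r addr0 mulrC.
Qed.

(** Halving the segment halves [b - a] and with it the lower bound [c]; the bounds of the two halves
    add up to [c] again. *)
Lemma segsum_Im (D : set C) (g : C -> C) m (a b : C) (c : R) : midconvex D ->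
  (forall z, D z -> c <= complex.Im ((b - a) * g z)) -> D a -> D b ->
  c <= complex.Im (segsum g m a b).
Proof.
move=> cD; elim: m a b c => [|m IH] a b c gc Da Db /=.
  rewrite [_ *: _]mulrDr raddfD /= !Im_half.
  have := gc _ Da; have := gc _ Db; lra.
have Dm := cD _ _ Da Db.
have h z : D z -> c / 2 <= complex.Im ((b - a) / 2 * g z).
  by move=> /gc; rewrite Im_half; lra.
rewrite raddfD /=.
have := IH a (mid a b) (c / 2); have := IH (mid a b) b (c / 2).
rewrite mid_subl mid_subr => /(_ h Dm Db) h1 /(_ h Da Dm) h2; lra.
Qed.

End CauchyEstimate.

(** * Sums over squares around 0 and Cauchy's estimate *)

Section Diamond.
Variable R : realType.
Local Notation C := (R[i]^o).
Local Notation I := (Complex 0 1 : C).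

Lemma sqrI : I * I = -1.
Proof. by rewrite -expr2 sqr_i. Qed.

Lemma I4 : I ^+ 4 = 1.
Proof. by rewrite -[4%N]/(2 * 2)%N exprM sqr_i sqrrN expr1n. Qed.

Lemma nrmI : nrm I = 1.
Proof. by rewrite /nrm normc_def /= expr0n add0r expr1n sqrtr1. Qed.

Lemma mid_scale (a b : C) : mid a b = (2^-1 : R)%:C * (a + b).
Proof. by rewrite fmorphV rmorph_nat /mid mulrC. Qed.

Lemma Re_mid (a b : C) :
  complex.Re (mid a b) = (complex.Re a + complex.Re b) / 2.
Proof.
rewrite mid_scale; case: a b => [u v] [u' v'] /=.
by rewrite mul0r subr0 mulrC.
Qed.

Lemma Im_mid (a b : C) :
  complex.Im (mid a b) = (complex.Im a + complex.Im b) / 2.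
Proof.
rewrite mid_scale; case: a b => [u v] [u' v'] /=.
by rewrite mul0r addr0 mulrC.
Qed.

(* The trapezoidal sum over the square with vertices s, is, -s, -is. *)
Definition diamond (g : C -> C) m (s : R) : C :=
  \sum_(k < 4) segsum g m (s%:C * I ^+ k) (s%:C * I ^+ k.+1).

(* The half plane supporting side [k] of the diamond of radius [s], cut by a disc. *)
Definition side_region (k : nat) (s r : R) : set C :=
  [set z | s <= complex.Re (z / I ^+ k) + complex.Im (z / I ^+ k) /\ nrm z <= r].

Lemma side_region_midconvex k s r : midconvex (side_region k s r).
Proof.
move=> a b [h1 h2] [h3 h4]; split.
  have -> : mid a b / I ^+ k = mid (a / I ^+ k) (b / I ^+ k).
    by rewrite /mid mulrAC mulrDl.
  rewrite Re_mid Im_mid; lra.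
rewrite /mid nrm_half; have := nrmD a b; lra.
Qed.

Lemma side_region_closed k s r : nrm_closed (side_region k s r).
Proof.
move=> z H; split; rewrite leNgt; apply/negP => lt.
  set A := complex.Re _ + _ in lt.
  have [|y [h1 h2] yz] := H ((s - A) / 2); first by rewrite divr_gt0 // subr_gt0.
  have E : y / I ^+ k = z / I ^+ k + (y - z) / I ^+ k.
    by rewrite -mulrDl addrC subrK.
  have := nrm_Re ((y - z) / I ^+ k); have := nrm_Im ((y - z) / I ^+ k).
  rewrite nrmM nrmV nrmX nrmI expr1n invr1 mulr1 !ler_norml.
  move: h1; rewrite E !raddfD /= -/A /A => h1 /andP[a1 a2] /andP[b1 b2].
  rewrite /A in yz; lra.
have [|y [h1 h2] yz] := H (nrm z - r); first by rewrite subr_gt0.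
by have := nrm_le_dist z y; rewrite nrm_distC; lra.
Qed.

(** Division by [I ^+ k] preserves the norm, and two reals with sum at least [s] cannot both be
    below [s / 2]. This keeps the region away from the pole at 0. *)
Lemma side_region_ge k s r z : side_region k s r z -> s / 2 <= nrm z.
Proof.
move=> [h _].
have := nrm_Re (z / I ^+ k); have := nrm_Im (z / I ^+ k).
rewrite nrmM nrmV nrmX nrmI expr1n invr1 mulr1 !ler_norml.
by move=> /andP[a1 a2] /andP[b1 b2]; lra.
Qed.

Lemma nrm_vertex k (t : R) : 0 <= t -> nrm (t%:C * I ^+ k : C) = t.
Proof. by move=> t0; rewrite nrmM nrmX nrmI expr1n mulr1 nrmR ger0_norm. Qed.

Lemma Iexp_neq0 k : I ^+ k != 0.
Proof. by rewrite -nrm_gt0 nrmX nrmI expr1n. Qed.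

Lemma side_region_vertex k s r t : 0 < s -> s <= t -> t <= r ->
  side_region k s r (t%:C * I ^+ k) /\ side_region k s r (t%:C * I ^+ k.+1).
Proof.
move=> s0 st tr; have t0 : 0 <= t by lra.
split; split; rewrite ?nrm_vertex //; first by rewrite mulfK ?Iexp_neq0 //= addr0.
by rewrite exprS mulrA mulfK ?Iexp_neq0 //= !(mulr0, mulr1, mul0r, oppr0, addr0, add0r).
Qed.

(** The four sides have length at most [2 * s] each. *)
Lemma diamond_le (g : C -> C) m (s B : R) : 0 < s ->
  (forall z, s / 2 <= nrm z -> nrm z <= s -> nrm (g z) <= B) ->
  nrm (diamond g m s) <= 8 * s * B.
Proof.
move=> s0 gB; apply: le_trans (nrm_sum _ _ _) _.
have -> : 8 * s * B = \sum_(k < 4) (B * (2 * s)).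
  by rewrite big_const card_ord /= addr0; ring.
apply: ler_sum => k _.
have [|||h1 h2] := @side_region_vertex k s s s; rewrite ?lexx //.
have B0 : 0 <= B.
  have := nrm_ge0 (g (s%:C)); move/le_trans; apply; apply: gB.
    by rewrite nrmR ger0_norm ?ltW //; lra.
  by rewrite nrmR ger0_norm // ltW.
apply: le_trans (@segsum_le _ _ _ g B m _ _ (@side_region_midconvex k s s) _ h1 h2) _.
  by move=> z Hz; apply: gB; [exact: side_region_ge Hz | case: Hz].
apply: ler_wpM2l => //; apply: le_trans (nrmB _ _) _.
by rewrite !(nrm_vertex _ (ltW s0)); lra.
Qed.

(* The annulus between the two diamonds is cut into eight triangles, each lying in
   a half plane which avoids 0. *)
Lemma diamond_annulus (g g' : C -> C) (s r e : R) : 0 < s -> s <= r -> 0 < e ->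
  (forall z, z != 0 -> nrm z <= r -> is_derive z (1 : C) g (g' z)) ->
  exists m, nrm (diamond g m r - diamond g m s) <= e.
Proof.
move=> s0 sr e0 dg; have r0 : 0 < r by lra.
pose v (t : R) k : C := t%:C * I ^+ k.
(* The boundary of the trapezoid between the two sides of index [k], closed up by the radial
   segments at its ends. *)
have /choice[n Hn] : forall k, exists m0, forall m, (m0 <= m)%N ->
    nrm (segsum g m (v r k) (v r k.+1) - segsum g m (v s k) (v s k.+1) +
         (segsum g m (v r k.+1) (v s k.+1) - segsum g m (v r k) (v s k))) <= e / 4.
  move=> k; have e8 : 0 < e / 8 by lra.
  have [|||ar br] := @side_region_vertex k s r r; rewrite ?lexx //.
  have [|||as_ bs] := @side_region_vertex k s r s; rewrite ?lexx //.
  have dgD z : side_region k s r z -> is_derive z (1 : C) g (g' z).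
    move=> Hz; apply: dg; last by case: Hz.
    by rewrite -nrm_gt0; have := side_region_ge Hz; lra.
  have [m1 H1] := goursat (@side_region_midconvex k s r)
    (@side_region_closed k s r) dgD ar br bs e8.
  have [m2 H2] := goursat (@side_region_midconvex k s r)
    (@side_region_closed k s r) dgD ar bs as_ e8.
  exists (maxn m1 m2) => m; rewrite geq_max => /andP[/H1 k1 /H2 k2].
  (* The trapezoid is cut along the diagonal from [v r k] to [v s k.+1]. *)
  have -> : segsum g m (v r k) (v r k.+1) - segsum g m (v s k) (v s k.+1) +
      (segsum g m (v r k.+1) (v s k.+1) - segsum g m (v r k) (v s k)) =
      trisum g m (v r k) (v r k.+1) (v s k.+1) + trisum g m (v r k) (v s k.+1) (v s k).
    rewrite /trisum (segsum_rev _ _ (v r k) (v s k.+1)).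
    rewrite (segsum_rev _ _ (v s k) (v s k.+1)) (segsum_rev _ _ (v r k) (v s k)).
    by ring.
  apply: le_trans (nrmD _ _) _; rewrite /v; lra.
pose m := (\max_(k < 4) n k)%N; exists m.
(* The radial contributions telescope over [k] and close up because [I ^+ 4 = 1]. *)
pose w k := segsum g m (v r k) (v s k).
have w4 : w 4%N = w 0%N.
  by rewrite /w /v I4 expr0.
have -> : diamond g m r - diamond g m s = \sum_(k < 4)
   (segsum g m (v r k) (v r k.+1) - segsum g m (v s k) (v s k.+1) +
     (w k.+1 - w k)).
  rewrite big_split /= sumrB -(big_mkord predT (fun k => w k.+1 - w k)).
  by rewrite telescope_sumr // w4 subrr addr0.
apply: le_trans (nrm_sum _ _ _) _.
have -> : e = \sum_(k < 4) (e / 4).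
  by rewrite big_const card_ord /= addr0; lra.
by apply: ler_sum => k _; apply: Hn; exact: (leq_bigmax k).
Qed.

Lemma diamondD (g h : C -> C) m s :
  diamond (fun z => g z + h z) m s = diamond g m s + diamond h m s.
Proof. by rewrite /diamond -big_split; apply: eq_bigr => k _; exact: segsumD. Qed.

Lemma diamondZ (c : C) (g : C -> C) m s :
  diamond (fun z => c * g z) m s = c * diamond g m s.
Proof. by rewrite /diamond mulr_sumr; apply: eq_bigr => k _; exact: segsumZ. Qed.

(* The kernel is even, so opposite sides cancel. *)
Lemma diamond_inv2 m s : diamond (fun z => z^-1 * z^-1) m s = 0.
Proof.
have odd a b : segsum (fun z : C => z^-1 * z^-1) m (- a) (- b) =
    - segsum (fun z : C => z^-1 * z^-1) m a b.
  rewrite -(mulN1r a) -(mulN1r b) segsum_scale mulN1r; congr (- _).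
  by apply: eq_segsum => z; rewrite mulN1r invrN mulrNN.
rewrite /diamond !big_ord_recl big_ord0 /= /bump /=.
have I2 : I ^+ 2 = -1 by rewrite expr2 sqrI.
have I3 : I ^+ 3 = - I by rewrite exprS I2 mulrN1.
rewrite I2 I3 I4 expr0 expr1 !mulrN !mulr1 odd.
by have := odd (s%:C * I) (- (s%:C : C)); rewrite opprK => ->; ring.
Qed.

(* By invariance of dz / z the sum is four times that over the segment from 1 to
   i, where the imaginary part of (i - 1) / z is at least 1. *)
Lemma diamond_inv m s : 0 < s -> 4 <= nrm (diamond (fun z => z^-1) m s).
Proof.
move=> s0.
have s1 : (s%:C : C) != 0 by rewrite -nrm_gt0 nrmR normr_gt0 gt_eqF.
have E k : segsum (fun z : C => z^-1) m (s%:C * I ^+ k) (s%:C * I ^+ k.+1) =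
    segsum (fun z : C => z^-1) m 1 I.
  have sk : s%:C * I ^+ k != 0 by rewrite mulf_neq0 ?Iexp_neq0.
  rewrite exprSr mulrA -[X in segsum _ _ X]mulr1 segsum_scale -segsumZ.
  by apply: eq_segsum => z; rewrite invfM mulrA mulfV // mul1r.
rewrite /diamond (eq_bigr (fun=> segsum (fun z : C => z^-1) m 1 I)); last first.
  by move=> k _; exact: E.
rewrite big_const card_ord.
set S := segsum _ _ _ _.
suff h : 1 <= complex.Im S.
  apply: le_trans (le_trans (ler_norm _) (nrm_Im _)).
  by rewrite /= addr0 !raddfD /=; lra.
pose D := [set z : C | [/\ complex.Re z + complex.Im z = 1, 0 <= complex.Re z &
   0 <= complex.Im z]].
apply: (@segsum_Im _ D); [| |by split; rewrite /= ?addr0|by split; rewrite /= ?add0r].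
  move=> a b [a1 a2 a3] [b1 b2 b3]; split; rewrite ?Re_mid ?Im_mid; lra.
move=> z [xy x0 y0]; set x := complex.Re z in xy x0; set y := complex.Im z in xy y0.
have xy2 : (x + y) ^+ 2 = 1 by rewrite xy expr1n.
have n0 : 0 < x ^+ 2 + y ^+ 2 by have := sqr_ge0 (x - y); lra.
have n1 : x ^+ 2 + y ^+ 2 <= 1 by have := mulr_ge0 x0 y0; lra.
have -> : z^-1 = (x ^+ 2 + y ^+ 2)^-1%:C * (x -i* y).
  apply: (mulr1_eq (x := z)); rewrite {1}[z](_ : z = x +i* y); last by rewrite /x /y; case: (z).
  apply/eqP; rewrite eq_complex /=; apply/andP; split; apply/eqP; field; lra.
(* The imaginary part of [(I - 1) / z] is [(x + y) / (x ^+ 2 + y ^+ 2)], where [x + y = 1] and the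
   denominator is at most 1. *)
rewrite /= (_ : _ + _ = (x ^+ 2 + y ^+ 2)^-1 * (x + y)); last by ring.
by rewrite xy mulr1 invf_ge1.
Qed.

Lemma derivable_kernel (f : C -> C) (l z : C) : z != 0 -> derivable f z (1 : C) ->
  derivable (fun z => (f z - f 0 - z * l) * (z^-1 * z^-1)) z (1 : C).
Proof.
move=> z0 df.
have dF : derivable (f - cst (f 0) - id * cst l : C -> C) z (1 : C).
  have dm := @derivableM R[i] C id (cst l) z 1 (@derivable_id _ _ _ _) (@derivable_cst _ _ _ _ _ _).
  have dc := @derivable_cst R[i] C C (f 0) z 1.
  exact: (derivableB (derivableB df dc) dm).
have dV : derivable (fun z : C => z^-1) z (1 : C).
  exact: (@derivableV R[i] C id z 1 z0 (@derivable_id _ _ _ _)).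
exact: (derivableM dF (derivableM dV dV)).
Qed.

(* With F(z) = f(z) - f(0) - z f'(0) = o(z), the sums of F(z) / z^2 over small
   diamonds are small, hence so is the one over the diamond of radius r, and the
   sum of f(z) / z^2 is close to f'(0) times that of 1 / z. *)
Lemma cauchy_estimate (f f' : C -> C) (r M : R) : 0 < r ->
  (forall z, nrm z <= r -> is_derive z (1 : C) f (f' z)) ->
  (forall z, nrm z <= r -> nrm (f z) <= M) ->
  nrm (f' 0) <= 8 * M / r.
Proof.
move=> r0 df fM.
pose F z := f z - f 0 - z * f' 0.
pose g z := F z * (z^-1 * z^-1).
have [g' dg] : exists g' : C -> C, forall z, z != 0 -> nrm z <= r ->
    is_derive z (1 : C) g (g' z).
  exists ('D_1 g) => z z0 zr; have [dfz _] := df z zr.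
  exact: (derivableP (@derivable_kernel f (f' 0) z z0 dfz)).
(* Of the 17, 16 come from [diamond_le] on the small diamond, where [g] is bounded by [2 * e / s],
   and 1 from the annulus. *)
have key e : 0 < e -> exists m, nrm (diamond g m r) <= 17 * e.
  move=> e0.
  have /is_derive_nrmP/(_ _ e0)[d d0 Hd] : is_derive (0 : C) (1 : C) f (f' 0).
    by apply: df; rewrite nrm0 ltW.
  pose s := Num.min (d / 2) r.
  have s0 : 0 < s by rewrite lt_min r0 divr_gt0.
  have sr : s <= r by rewrite ge_min lexx orbT.
  have sd : s < d by rewrite gt_min; apply/orP; left; lra.
  have [m Hm] := diamond_annulus s0 sr e0 dg; exists m.
  have gs z : s / 2 <= nrm z -> nrm z <= s -> nrm (g z) <= 2 * e / s.
    move=> h1 h2; have z0 : 0 < nrm z by lra.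
    have hF : nrm (F z) <= e * nrm z by have := Hd z; rewrite add0r; apply; lra.
    have zV : (nrm z)^-1 <= (s / 2)^-1 by rewrite lef_pV2 ?posrE //; lra.
    rewrite /g !nrmM nrmV mulrA (_ : 2 * e / s = e * (s / 2)^-1); last by field; lra.
    apply: ler_pM => //; rewrite ?invr_ge0 ?ler_pdivrMr // ?(ltW z0) //.
    by rewrite mulr_ge0 ?invr_ge0 ?nrm_ge0.
  have hs := diamond_le m s0 gs.
  have -> : 17 * e = 8 * s * (2 * e / s) + e by field; lra.
  by apply: le_trans (nrm_le_dist _ (diamond g m s)) _; lra.
rewrite leNgt; apply/negP => lt.
(* With this [e] the estimates [h1] to [h5] give [4 * nrm (f' 0) <= 4 * (8 * M / r) + (nrm (f' 0) -
   8 * M / r)], contradicting [lt]. *)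
pose e := (nrm (f' 0) - 8 * M / r) / 17.
have e0 : 0 < e by rewrite divr_gt0 // subr_gt0.
have [m Hm] := key _ e0.
(* The integrand is [g z + f' 0 / z + f 0 / z ^+ 2], whose last term sums to 0. The identity also
   holds at [z = 0], where inverses are 0. *)
have E : diamond (fun z => f z * (z^-1 * z^-1)) m r =
    diamond g m r + f' 0 * diamond (fun z => z^-1) m r.
  transitivity (diamond g m r + f' 0 * diamond (fun z => z^-1) m r +
    f 0 * diamond (fun z => z^-1 * z^-1) m r); last by rewrite diamond_inv2 mulr0 addr0.
  rewrite -!diamondZ -!diamondD /diamond; apply: eq_bigr => k _.
  apply: eq_segsum => z; rewrite /g /F.
  have [->|z0] := eqVneq z 0; first by rewrite invr0 !mulr0 !addr0.
  by field.
have h1 : nrm (diamond (fun z => f z * (z^-1 * z^-1)) m r) <=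
    8 * r * (M * ((r / 2)^-1 * (r / 2)^-1)).
  apply: diamond_le => // z z1 z2; rewrite !nrmM nrmV.
  have zV : (nrm z)^-1 <= (r / 2)^-1 by rewrite lef_pV2 ?posrE //; lra.
  have zV0 : 0 <= (nrm z)^-1 by rewrite invr_ge0 nrm_ge0.
  apply: ler_pM => //; [exact: nrm_ge0|by rewrite mulr_ge0|exact: fM|].
  by apply: ler_pM.
have h2 := diamond_inv m r0.
have h3 : nrm (f' 0) * 4 <= nrm (f' 0 * diamond (fun z => z^-1) m r).
  by rewrite nrmM ler_wpM2l // nrm_ge0.
have h4 : nrm (f' 0 * diamond (fun z => z^-1) m r) <=
    nrm (diamond (fun z => f z * (z^-1 * z^-1)) m r) + nrm (diamond g m r).
  rewrite E; set u := _ * _; set v := diamond g m r.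
  by rewrite -{1}[u](addrK v) [u + v]addrC; exact: nrmB.
have h5 : 8 * r * (M * ((r / 2)^-1 * (r / 2)^-1)) = 4 * (8 * M / r) by field; lra.
rewrite /e in e0 Hm; lra.
Qed.

End Diamond.

(** * Differentials of holomorphic maps *)

Section VectorNorm.
Variables (R : realType) (n : nat).
Local Notation C := (R[i]^o).
Local Notation V := ('rV[C]_n).

Lemma nrm_coord (x : V) j : nrm (x 0 j) <= nrm x.
Proof.
rewrite -lecR -!nrmE [in leRHS]/Num.norm /= mx_normE.
have -> : `|x 0 j| = (`|x 0 j|%:nng)%:num by [].
by rewrite num_le; apply/bigmax_geP; right; exists (0, j).
Qed.

Lemma nrm_row_le (x : V) (B : R) : 0 <= B -> (forall j, nrm (x 0 j) <= B) ->
  nrm x <= B.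
Proof.
move=> B0 H; rewrite -lecR -nrmE [in leLHS]/Num.norm /=.
have [->|x0] := eqVneq (mx_norm x) 0; first by rewrite lecR.
have [[i j] ->] := mx_norm_neq0 x0; rewrite [leLHS](nrmE (x i j)) lecR (ord1 i).
exact: H.
Qed.

Lemma cvg_dyadic_row (a : nat -> V) (d : R) :
  (forall k, nrm (a k.+1 - a k) <= d / 2 ^+ k) ->
  exists z, forall k, nrm (a k - z) <= 4 * (d / 2 ^+ k).
Proof.
move=> H; have d0 : 0 <= d.
  by have := le_trans (nrm_ge0 _) (H 0%N); rewrite expr0 divr1.
have /choice[z Hz] : forall j, exists z : C, forall k,
    nrm (a k 0 j - z) <= 4 * (d / 2 ^+ k).
  move=> j; apply: cvg_dyadic => k; apply: le_trans (H k).
  by have := nrm_coord (a k.+1 - a k) j; rewrite !mxE.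
exists (\row_j z j) => k; apply: nrm_row_le => [|j]; last by rewrite !mxE.
by rewrite mulr_ge0 // divr_ge0 // exprn_ge0.
Qed.

End VectorNorm.

(** * First order estimates by restriction to complex lines *)

Section Holomorphic.
Variable R : realType.
Local Notation C := (R[i]^o).
Implicit Types E W : normedModType R[i].

Lemma linear_nrm_continuous E W (L : E -> W) (K : R) : linear L ->
  (forall h, nrm (L h) <= K * nrm h) -> continuous L.
Proof.
move=> lL LK x A /nbhs_nrmP[e e0 sA]; apply/nbhs_nrmP.
have K0 : 0 < `|K| + 1 by rewrite ltr_wpDl.
exists (e / (`|K| + 1)); first by rewrite divr_gt0.
move=> y yx; apply: sA.
have -> : L y - L x = L (y - x).
  by have := lL (-1) x y; rewrite !scaleN1r [- x + y]addrC => ->; rewrite addrC.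
apply: le_lt_trans (LK _) _; rewrite ltr_pdivlMr // in yx.
apply: le_lt_trans yx; rewrite mulrC ler_wpM2l ?nrm_ge0 //.
by have := ler_norm K; lra.
Qed.

Lemma is_derive_line E W (Y : E -> W) x h (z : C) : differentiable Y (x + z *: h) ->
  is_derive z (1 : C) (fun z => Y (x + z *: h)) ('d Y (x + z *: h) h).
Proof.
move=> dY; apply/is_derive_nrmP => e e0.
have e1 : 0 < e / (nrm h + 1) by rewrite divr_gt0 // ltr_wpDl // nrm_ge0.
have [d d0 Hd] := diff_nrm dY e1.
have h1 : 0 < nrm h + 1 by rewrite ltr_wpDl // nrm_ge0.
exists (d / (nrm h + 1)) => [|k kd]; first by rewrite divr_gt0.
have kh : nrm k * nrm h <= nrm k * (nrm h + 1).
  by rewrite ler_wpM2l ?nrm_ge0 // lerDl.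
rewrite scalerDl addrA; have := Hd (k *: h); rewrite linearZ /= nrmZ => /(_ _)H.
apply: le_trans (H _) _; first by rewrite ltr_pdivlMr // in kd; exact: le_lt_trans kd.
by rewrite mulrAC ler_pdivrMr // -mulrA ler_wpM2l // ltW.
Qed.

(** The parameters for which a line lies in a closed ball form the domains to which [mean_value_le]
    is applied; convexity of the norm gives stability under midpoints. *)
Lemma line_disc_midconvex E (x u w : E) (r : R) :
  midconvex [set z : C | nrm (u + z *: w - x) <= r].
Proof.
move=> a b /= ha hb.
have -> : u + mid a b *: w - x =
    (1 / 2 : C) *: (u + a *: w - x) + (1 / 2 : C) *: (u + b *: w - x).
  rewrite ![u + _ - x]addrAC; move: (u - x) => v.
  rewrite !scalerDr !scalerA addrACA -!scalerDl -[X in X + _ = _]scale1r.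
  by congr (_ *: _ + _ *: _); rewrite /mid; field.
have h2 : nrm (1 / 2 : C) = 1 / 2 by rewrite nrm_half nrm1.
apply: le_trans (nrmD _ _) _; rewrite !nrmZ h2; lra.
Qed.

Lemma line_disc_closed E (x u w : E) (r : R) :
  nrm_closed [set z : C | nrm (u + z *: w - x) <= r].
Proof.
move=> z /= H; rewrite leNgt; apply/negP => lt.
have w1 : 0 < nrm w + 1 by rewrite ltr_wpDl // nrm_ge0.
have [|y /= hy] := H ((nrm (u + z *: w - x) - r) / (nrm w + 1)).
  by rewrite divr_gt0 // subr_gt0.
rewrite ltr_pdivlMr // => yz.
have := nrm_le_dist (u + z *: w - x) (u + y *: w - x).
have -> : u + z *: w - x - (u + y *: w - x) = (z - y) *: w.
  by rewrite scalerBl opprB addrA subrK opprD addrACA subrr add0r.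
rewrite nrmZ (nrm_distC z); have := nrm_ge0 (y - z); lra.
Qed.

Lemma diff_mean_value E W (Y : E -> W) x a b (r K : R) :
  (forall y, nrm (y - x) <= r -> differentiable Y y) ->
  (forall y, nrm (y - x) <= r -> nrm ('d Y y (b - a)) <= K) ->
  nrm (a - x) <= r -> nrm (b - x) <= r -> nrm (Y b - Y a) <= K.
Proof.
move=> dY YK ar br.
have := @mean_value_le _ _ _ (fun z => Y (a + z *: (b - a)))
  (fun z => 'd Y (a + z *: (b - a)) (b - a)) K 0 1
  (@line_disc_midconvex _ x a (b - a) r) (@line_disc_closed _ x a (b - a) r).
rewrite /= scale0r scale1r addr0 [a + _]addrC subrK subr0 nrm1 mulr1; apply => //.
- by move=> z /= Hz; apply: is_derive_line; exact: dY.
- by move=> z /= Hz; exact: YK.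
Qed.

(** The one variable estimate is applied to each coordinate of [Y] on the line through [x] along
    [h], which stays in the ball up to parameter [r / nrm h]. *)
Lemma diff_cauchy E (n : nat) (Y : E -> 'rV[C]_n) x (r M : R) : 0 < r ->
  (forall y, nrm (y - x) <= r -> differentiable Y y) ->
  (forall y, nrm (y - x) <= r -> nrm (Y y) <= M) ->
  forall h, nrm ('d Y x h) <= 8 * M / r * nrm h.
Proof.
move=> r0 dY YM h.
have [->|h0] := eqVneq h 0; first by rewrite linear0 !nrm0 mulr0.
have nh : 0 < nrm h by rewrite nrm_gt0.
have M0 : 0 <= M by apply: le_trans (nrm_ge0 _) (YM x _); rewrite subrr nrm0 ltW.
apply: nrm_row_le => [|j]; first by rewrite !mulr_ge0 ?invr_ge0 ?nrm_ge0 // ltW.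
pose f z := Y (x + z *: h) 0 j; pose f' z := 'd Y (x + z *: h) h 0 j.
have near_x (z : C) : nrm z <= r / nrm h -> nrm (x + z *: h - x) <= r.
  by rewrite addrC addKr nrmZ ler_pdivlMr.
have := @cauchy_estimate _ f f' (r / nrm h) M.
rewrite /f' scale0r addr0 invf_div mulrA [in leRHS]mulrAC; apply.
- by rewrite divr_gt0.
- move=> z /near_x /dY /is_derive_line /is_derive_nrmP H.
  apply/is_derive_nrmP => e /H[d d0 Hd]; exists d => // k /Hd.
  by apply: le_trans; apply: le_trans (nrm_coord _ j); rewrite !mxE.
- by move=> z /near_x /YM; apply: le_trans; exact: nrm_coord.
Qed.

End Holomorphic.

(** * The second order remainder *)

Section SecondOrder.
Variable R : realType.
Local Notation C := (R[i]^o).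
Implicit Types E W : normedModType R[i].

Lemma diff_shift E W (Y : E -> W) k x : differentiable Y (x + k) ->
  differentiable (fun z => Y (z + k)) x /\
  'd (fun z => Y (z + k)) x = 'd Y (x + k) :> (E -> W).
Proof.
move=> dY; apply: diff_nrmP.
- by move=> u y z; rewrite linearP.
- exact: diff_continuous.
- move=> e e0; have [d d0 Hd] := diff_nrm dY e0; exists d => // h /Hd.
  by rewrite [x + k + h]addrAC.
Qed.

(* Cauchy's estimate is applied twice: to Y, so that Y is Lipschitz, and then to
   the increments of Y, so that dY is Lipschitz. *)
Lemma quadratic_remainder E (n : nat) (Y : E -> 'rV[C]_n) x (r M : R) : 0 < r ->
  (forall y, nrm (y - x) <= 4 * r -> differentiable Y y) ->
  (forall y, nrm (y - x) <= 4 * r -> nrm (Y y) <= M) ->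
  forall k, nrm k <= r ->
  nrm (Y (x + k) - Y x - 'd Y x k) <= 64 * M / r ^+ 2 * nrm k ^+ 2.
Proof.
move=> r0 dY YM k kr.
pose K := 8 * M / r.
have YK y h : nrm (y - x) <= 3 * r -> nrm ('d Y y h) <= K * nrm h.
  move=> yx; apply: diff_cauchy => // z zy; [apply: dY|apply: YM];
    by apply: le_trans (nrm_distD y z x) _; lra.
have dY3 y : nrm (y - x) <= 3 * r -> differentiable Y y.
  by move=> yx; apply: dY; lra.
have dK j h : nrm j <= r ->
    nrm ('d Y (x + j) h - 'd Y x h) <= 8 * (K * nrm j) / r * nrm h.
  move=> jr.
  pose S z := Y (z + j).
  have dZ z : nrm (z - x) <= r -> differentiable (S - Y) z.
    move=> zx; apply: differentiableB; last by apply: dY; lra.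
    have dYz : differentiable Y (z + j).
      by apply: dY; rewrite addrAC; apply: le_trans (nrmD _ _) _; lra.
    by have [dS _] := diff_shift dYz.
  have xx : nrm (x - x) <= r by rewrite subrr nrm0 ltW.
  have dYx : differentiable Y x by apply: dY; lra.
  have dYxj : differentiable Y (x + j) by apply: dY; rewrite addrC addKr; lra.
  have [dS DS] := diff_shift dYxj.
  have dS' : differentiable S x := dS.
  have DSh : 'd (S - Y) x h = 'd Y (x + j) h - 'd Y x h.
    have -> : 'd Y (x + j) h = 'd S x h by rewrite -[LHS](congr1 (@^~ h) DS).
    exact: (congr1 (@^~ h) (diffB dS' dYx)).
  apply: (eq_ind _ (fun u => nrm u <= _) _ _ DSh).
  apply: diff_cauchy => // z zx.
  have zjx : nrm (z + j - x) <= 3 * r.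
    by rewrite addrAC; apply: le_trans (nrmD _ _) _; lra.
  apply: (@diff_mean_value _ _ _ Y x z (z + j) (3 * r)) => //; last by lra.
  by move=> y yx; rewrite [z + j]addrC addrK; exact: YK.
pose D := [set z : C | nrm (x + z *: k - x) <= nrm k].
(* Without its linear part, [Y] along the segment has derivative [f'], which the Lipschitz bound
   [dK] on the differential makes quadratic in [k]. *)
pose f z := Y (x + z *: k) - z *: 'd Y x k.
pose f' z := 'd Y (x + z *: k) k - 'd Y x k.
have Dk z : D z -> nrm (z *: k) <= nrm k by rewrite /D /= [x + _]addrC addrK.
have df z : D z -> is_derive z (1 : C) f (f' z).
  move=> Dz; have : differentiable Y (x + z *: k) by apply: dY; move: Dz; rewrite /D /=; lra.
  move=> /is_derive_line/is_derive_nrmP H; apply/is_derive_nrmP => e /H[d d0 Hd].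
  exists d => // h /Hd.
  suff -> : f (z + h) - f z - h *: f' z =
    Y (x + (z + h) *: k) - Y (x + z *: k) - h *: 'd Y (x + z *: k) k by [].
  rewrite /f /f' scalerBr [(z + h) *: 'd Y x k]scalerDl.
  move: (Y _) (Y _) (z *: 'd Y x k) (h *: 'd Y x k) (h *: _) => a b c d' e'.
  rewrite !opprD !opprK [LHS](AC (1*2*2*2) (1*4*6*(2*5)*(3*7)))%AC /=.
  by rewrite !addNr !addr0.
have f'M z : D z -> nrm (f' z) <= 64 * M / r ^+ 2 * nrm k ^+ 2.
  move=> Dz; have h := Dk _ Dz; apply: le_trans (dK (z *: k) k _) _; first by lra.
  have M0 : 0 <= M by apply: le_trans (nrm_ge0 _) (YM x _); rewrite subrr nrm0; lra.
  have K0 : 0 <= K / r by rewrite !mulr_ge0 ?invr_ge0 // ltW.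
  have -> : 64 * M / r ^+ 2 * nrm k ^+ 2 = 8 * (K / r) * (nrm k * nrm k).
    by rewrite /K; field; lra.
  rewrite (_ : _ * nrm k = 8 * (K / r) * (nrm (z *: k) * nrm k)); last by ring.
  by rewrite !ler_wpM2l ?ler_wpM2r ?nrm_ge0 // mulr_ge0.
have := mean_value_le (@line_disc_midconvex _ _ x x k (nrm k))
  (@line_disc_closed _ _ x x k (nrm k)) df f'M.
move=> /(_ 0 1); rewrite /D /f /= !scale0r !scale1r !addr0 subr0 subrr nrm0 subr0 nrm1 mulr1.
rewrite [x + k]addrC addrK -addrA [- _ - _]addrC addrA.
by apply; rewrite ?nrm_ge0.
Qed.

End SecondOrder.

(** * Differentiability of directional derivatives *)

Section DerivativeHolomorphic.
Variable R : realType.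
Local Notation C := (R[i]^o).
Implicit Types E W : normedModType R[i].

Lemma le_dyadic_lim (a b d : R) : (forall k, a <= b + d / 2 ^+ k) -> a <= b.
Proof.
move=> H; rewrite leNgt; apply/negP => ab.
have ab0 : 0 < a - b by rewrite subr_gt0.
by have [k Hk] := dyadic_small d ab0; have := H k; lra.
Qed.

Lemma dyadic_le_self (a : R) k : 0 <= a -> a / 2 ^+ k <= a.
Proof.
move=> a0; rewrite ler_pdivrMr ?exprn_gt0 // -[leLHS]mulr1 ler_wpM2l //.
by rewrite exprn_ege1 // ler1n.
Qed.

(* G = dY(.)(v) is the limit of difference quotients Q_k of Y, whose differentials
   at x converge by Cauchy's estimate for Q_(k+1) - Q_k, and whose quadratic
   remainders are bounded uniformly in k. *)
Lemma diff_dir_differentiable E (n : nat) (Y : E -> 'rV[C]_n) x (r M : R) v :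
  0 < r ->
  (forall y, nrm (y - x) <= 6 * r -> differentiable Y y) ->
  (forall y, nrm (y - x) <= 6 * r -> nrm (Y y) <= M) ->
  differentiable (fun y => 'd Y y v) x.
Proof.
move=> r0 dY YM; pose G y := 'd Y y v.
have v1 : 0 < nrm v + 1 by rewrite ltr_wpDl // nrm_ge0.
(* All shifts [(s k)%:C *: v] then have norm at most [r]; the added 1 covers [v = 0]. *)
pose t := r / (nrm v + 1); have t0 : 0 < t by rewrite divr_gt0.
pose s k := t / 2 ^+ k.
have s0 k : 0 < s k by rewrite divr_gt0 // exprn_gt0.
have st k : s k <= t.
  exact: dyadic_le_self (ltW t0).
have sv k : nrm ((s k)%:C *: v) <= r.
  rewrite nrmZ nrmR gtr0_norm //; apply: le_trans (_ : t * (nrm v + 1) <= _).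
    by apply: ler_pM; [exact: ltW | exact: nrm_ge0 | exact: st | rewrite lerDl].
  by rewrite /t divfK // gt_eqF.
pose D k : E -> 'rV[C]_n := (fun y => Y (y + (s k)%:C *: v)) - Y.
pose Q k : E -> 'rV[C]_n := (s k)^-1%:C \*: D k.
have dQ k y : nrm (y - x) <= 2 * r -> differentiable (Q k) y.
  move=> yx; apply: differentiableZ; apply: differentiableB; last by apply: dY; lra.
  have dYy : differentiable Y (y + (s k)%:C *: v).
    apply: dY; rewrite addrAC; apply: le_trans (nrmD _ _) _; have := sv k; lra.
  by have [d1 _] := diff_shift dYy.
have M0 : 0 <= M by apply: le_trans (nrm_ge0 _) (YM x _); rewrite subrr nrm0; lra.
pose K := 64 * M / r ^+ 2; have K0 : 0 <= K.
  by rewrite !mulr_ge0 ?invr_ge0 ?exprn_ge0 // ltW.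
pose c := K * nrm v ^+ 2 * t.
have c0 : 0 <= c by apply: mulr_ge0 (ltW t0); rewrite mulr_ge0 // exprn_ge0 ?nrm_ge0.
have near_y y z : nrm (y - x) <= 2 * r -> nrm (z - y) <= 4 * r -> nrm (z - x) <= 6 * r.
  by move=> yx zy; apply: le_trans (nrm_distD y z x) _; lra.
(* The quadratic remainder for the shift [(s k)%:C *: v], divided by [s k], is of order [s k]. *)
have QG k y : nrm (y - x) <= 2 * r -> nrm (Q k y - G y) <= c / 2 ^+ k.
  move=> yx; have := @quadratic_remainder R E n Y y r M r0
    (fun z zy => dY z (near_y _ _ yx zy)) (fun z zy => YM z (near_y _ _ yx zy)) _ (sv k).
  have -> : Q k y - G y =
      (s k)^-1%:C *: (Y (y + (s k)%:C *: v) - Y y - 'd Y y ((s k)%:C *: v)).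
    rewrite linearZ /= [in RHS]scalerBr scalerA -rmorphM mulVf ?gt_eqF // scale1r.
    by [].
  rewrite !nrmZ !nrmR !gtr0_norm ?invr_gt0 // => h.
  apply: le_trans (ler_wpM2l (ltW _) h) _; first by rewrite invr_gt0.
  rewrite -/K [leLHS](_ : _ = K * nrm v ^+ 2 * s k); last first.
    by field; rewrite gt_eqF.
  by rewrite /c /s mulrA.
clearbody Q.
pose M' := 8 * M / r * nrm v + c.
have QM k y : nrm (y - x) <= 2 * r -> nrm (Q k y) <= M'.
  move=> yx; apply: le_trans (nrm_le_dist _ (G y)) _; apply: lerD.
    by apply: diff_cauchy => // z zy; [apply: dY|apply: YM]; apply: near_y yx _; lra.
  apply: le_trans (QG k y yx) _.
  exact: dyadic_le_self.
pose K' := 64 * M' / (r / 2) ^+ 2.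
have QK k h : nrm h <= r / 2 ->
    nrm (Q k (x + h) - Q k x - 'd (Q k) x h) <= K' * nrm h ^+ 2.
  move=> hr; apply: quadratic_remainder => // [|y|y]; first by rewrite divr_gt0.
    by rewrite (_ : 4 * (r / 2) = 2 * r); [exact: dQ|lra].
  by rewrite (_ : 4 * (r / 2) = 2 * r); [exact: QM|lra].
have xx : nrm (x - x) <= 2 * r by rewrite subrr nrm0; lra.
have r2 : 0 < 2 * r by lra.
have LL k h : nrm ('d (Q k.+1) x h - 'd (Q k) x h) <= (8 * c / r * nrm h) / 2 ^+ k.
  have E0 : 'd (Q k.+1 - Q k) x h = 'd (Q k.+1) x h - 'd (Q k) x h.
    exact: (congr1 (@^~ h) (diffB (dQ k.+1 x xx) (dQ k x xx))).
  apply: (eq_ind _ (fun u => nrm u <= _) _ _ E0).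
  have -> : 8 * c / r * nrm h / 2 ^+ k = 8 * (2 * (c / 2 ^+ k)) / (2 * r) * nrm h.
    by field; rewrite ?(gt_eqF r0) expf_neq0 /= ?pnatr_eq0.
  apply: (@diff_cauchy _ _ _ (Q k.+1 - Q k) x (2 * r) _ r2) => y yx.
    exact: (differentiableB (dQ k.+1 y yx) (dQ k y yx)).
  have h1 := QG k.+1 y yx; have h2 := QG k y yx.
  apply: le_trans (nrm_distD (G y) _ _) _; rewrite (nrm_distC (G y)).
  have : c / 2 ^+ k.+1 <= c / 2 ^+ k.
    by rewrite ler_wpM2l // lef_pV2 ?posrE ?exprn_gt0 // ler_eXn2l // ltr1n.
  lra.
have /choice[L HL] : forall h, exists l, forall k,
    nrm ('d (Q k) x h - l) <= 4 * ((8 * c / r * nrm h) / 2 ^+ k).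
  by move=> h; apply: cvg_dyadic_row => k; exact: LL.
(* The defect of linearity of [L] is bounded by a constant over [2 ^+ k] for every [k], since each
   differential is linear. *)
have lL : linear L.
  move=> a u w; apply/eqP; rewrite -subr_eq0 -nrm_eq0 eq_le nrm_ge0 andbT.
  apply: (@le_dyadic_lim _ _ (32 * c / r *
    (nrm (a *: u + w) + nrm (a : C) * nrm u + nrm w))) => k.
  have := HL (a *: u + w) k; have := HL w k; have := HL u k.
  move=> /(ler_wpM2l (nrm_ge0 (a : C))) h1 h2 h3.
  have -> : L (a *: u + w) - (a *: L u + L w) = a *: ('d (Q k) x u - L u) +
      ('d (Q k) x w - L w) - ('d (Q k) x (a *: u + w) - L (a *: u + w)).
    rewrite [in RHS]linearP /= scalerBr !opprD.
    move: (L (_ + _)) ('d _ _ w) (_ *: 'd _ _ u) (L w) (_ *: L u) => l b1 b2 l1 l2.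
    by rewrite opprK [RHS](AC (2*2*3) (7*(2*4)*(1*5)*(3*6)))%AC /= !subrr !addr0.
  apply: le_trans (nrmB _ _) _; apply: le_trans (lerD (nrmD _ _) (lexx _)) _.
  by rewrite nrmZ; move: (2 ^+ k)^-1 (r^-1) h1 h2 h3 => q p; lra.
have bL h : nrm (L h) <= (8 * M' / (2 * r) + 32 * c / r) * nrm h.
  apply: le_trans (nrm_le_dist _ ('d (Q 0%N) x h)) _.
  have := HL h 0%N; rewrite expr0 divr1 nrm_distC => h1.
  have := @diff_cauchy _ _ _ (Q 0%N) x (2 * r) M' r2 (dQ 0%N) (QM 0%N) h; lra.
have [|//] := @diff_nrmP R E _ G x L lL (linear_nrm_continuous lL bL).
move=> e e0; have M'0 : 0 <= M' := le_trans (nrm_ge0 _) (QM 0%N x xx).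
have r2' : 0 < r / 2 by lra.
have K'0 : 0 <= K' by rewrite divr_ge0 ?mulr_ge0 ?exprn_ge0 // ltW.
exists (Num.min (r / 2) (e / (K' + 1))).
  by rewrite lt_min !divr_gt0 // ltr_wpDl.
move=> h; rewrite lt_min => /andP[/ltW h1 h2].
apply: (@le_trans _ _ (K' * nrm h ^+ 2)); last first.
  rewrite expr2 mulrA ler_wpM2r ?nrm_ge0 //.
  move: h2; rewrite ltr_pdivlMr ?ltr_wpDl // => h2; have := nrm_ge0 h; nra.
(* For fixed [h], replacing [G] by [Q k] and [L] by the differential of [Q k] costs errors that
   vanish as [k] grows; only the remainder of [Q k], uniform in [k], stays. *)
apply: (@le_dyadic_lim _ _ (c + c + 32 * c / r * nrm h)) => k.
have hx : nrm (x + h - x) <= 2 * r by rewrite [x + h]addrC addrK; lra.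
have k1 := QG k _ hx; have k2 := QG k _ xx; have k3 := HL h k; have k4 := QK k h h1.
have -> : G (x + h) - G x - L h = (Q k (x + h) - Q k x - 'd (Q k) x h)
  - (Q k (x + h) - G (x + h)) + (Q k x - G x) + ('d (Q k) x h - L h).
  move: (G _) (G _) (Q _ _) (Q _ _) (L h) ('d _ _ h) => g1 g2 q1 q2 l d.
  rewrite !opprD !opprK [RHS](AC (3*2*2*2) (5*7*9*(1*4)*(2*6)*(3*8)))%AC /=.
  by rewrite subrr !addNr !addr0.
rewrite [leRHS](_ : _ = K' * nrm h ^+ 2 + c / 2 ^+ k + c / 2 ^+ k +
  4 * (8 * c / r * nrm h / 2 ^+ k)); last by ring.
apply: le_trans (nrmD _ _) (lerD _ k3).
apply: le_trans (nrmD _ _) (lerD _ k2).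
exact: le_trans (nrmB _ _) (lerD k4 k1).
Qed.

End DerivativeHolomorphic.

(** * Polynomial flows *)

Section LieIterates.
Variables (R : realType) (n : nat).
Local Notation C := (R[i]^o).
Local Notation V := ('rV[C]_n).
Implicit Types (U : set V) (X Y : V -> V).

Lemma holomorphic_dir U Y v : open U -> holomorphic_on U Y ->
  holomorphic_on U (fun x => 'd Y x v).
Proof.
move=> oU hY x Ux.
have /nbhs_nrmP[d1 d10 H1] : nbhs x U by exact: open_nbhs_nbhs.
have cY : {for x, continuous Y} by exact/differentiable_continuous/hY.
have /nbhs_nrmP[d2 d20 H2] : nbhs x (Y @^-1` [set y | nrm (y - Y x) < 1]).
  by apply: cY; apply/nbhs_nrmP; exists 1.
(* Any divisor above 6 puts the ball of radius [6 * r] inside both neighbourhoods. *)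
pose r := Num.min d1 d2 / 7.
have r0 : 0 < r by rewrite divr_gt0 // lt_min d10.
have r1 : 6 * r < d1.
  have : Num.min d1 d2 <= d1 by rewrite ge_min lexx.
  rewrite /r in r0 *; lra.
have r2 : 6 * r < d2.
  have : Num.min d1 d2 <= d2 by rewrite ge_min lexx orbT.
  rewrite /r in r0 *; lra.
apply: (@diff_dir_differentiable R V n Y x r (nrm (Y x) + 1) v r0) => y yx.
  by apply: hY; apply: H1; exact: le_lt_trans yx r1.
have := H2 y (le_lt_trans yx r2) => /= h.
by have := nrm_le_dist (Y y) (Y x); lra.
Qed.

Lemma diff_coordE Y x w :
  'd Y x w = \sum_i \sum_j (w 0 i * 'd Y x (delta_mx 0 i) 0 j) *: delta_mx 0 j.
Proof.
rewrite {1}[w]row_sum_delta linear_sum /=; apply: eq_bigr => i _.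
rewrite linearZ /= {1}['d Y x _]row_sum_delta scaler_sumr.
by apply: eq_bigr => j _; rewrite scalerA.
Qed.

(** The direction varies with the point, so it is expanded in the canonical basis: this leaves sums
    of products of coordinates of [X] with derivatives of [Y] in constant directions. *)
Lemma holomorphic_lie U X Y : open U -> holomorphic_on U X -> holomorphic_on U Y ->
  holomorphic_on U (fun x => 'd Y x (X x)).
Proof.
move=> oU hX hY x Ux.
have dc (Z : V -> V) j : differentiable Z x -> differentiable (fun y => Z y 0 j : C) x.
  move=> dZ; exact: (@differentiable_comp _ _ _ _ Z (fun M : V => M 0 j : C) x dZ
    (differentiable_coord (Z x) 0 j)).
pose F i j y : V := (X y 0 i * 'd Y y (delta_mx 0 i) 0 j) *: delta_mx 0 j.
have dF i j : differentiable (F i j) x.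
  apply: differentiableZl; apply: differentiableM; first exact: (dc X i (hX x Ux)).
  exact: (dc (fun y => 'd Y y (delta_mx 0 i)) j (holomorphic_dir (delta_mx 0 i) oU hY Ux)).
suff -> : (fun x => 'd Y x (X x)) = \sum_i \sum_j F i j.
  by apply: differentiable_sum => i; exact: differentiable_sum.
apply/funext => y; rewrite [LHS]diff_coordE [in RHS]fct_sumE; apply: eq_bigr => i _.
by rewrite [in RHS]fct_sumE.
Qed.

(** The iterated Lie derivatives along [X] of the coordinate functions. *)
Definition lie_iter X j : V -> V := iter j (fun Y x => 'd Y x (X x)) id.

Lemma lie_iter1 X : lie_iter X 1 = X.
Proof.
by apply/funext => x; rewrite /lie_iter /= (diff_val (f := id) (df := id)).
Qed.

Lemma holomorphic_lie_iter U X j : open U -> holomorphic_on U X ->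
  holomorphic_on U (lie_iter X j).
Proof.
move=> oU hX; elim: j => [|j IH]; last exact: holomorphic_lie.
by move=> x _; exact: ex_diff.
Qed.

Lemma is_derive_comp_diff (E W : normedModType R[i]) (Y : E -> W) (u : C -> E) t w :
  differentiable Y (u t) -> is_derive t (1 : C) u w ->
  is_derive t (1 : C) (Y \o u) ('d Y (u t) w).
Proof.
move=> dY [du <-].
have du' : differentiable u t by apply/derivable1_diffP.
have dYu := differentiable_comp du' dY.
apply: DeriveDef; first exact/derivable1_diffP.
rewrite (deriveE (1 : C) dYu) (deriveE (1 : C) du').
exact: (congr1 (@^~ (1 : C)) (diff_comp du' dY)).
Qed.

(** A map that vanishes on an open set has zero differential there, so every later iterate vanishes
    too. *)
Lemma lie_iter_vanish U X N : open U -> holomorphic_on U X ->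
  (forall x, U x -> lie_iter X N x = 0) ->
  forall j x, (N <= j)%N -> U x -> lie_iter X j x = 0.
Proof.
move=> oU hX H j x /subnK <-; elim: (j - N)%N x => [|k IH] x Ux; first exact: H.
rewrite addSn /lie_iter iterS -/(lie_iter X (k + N)).
have nz : \forall y \near x, lie_iter X (k + N) y = (cst 0 : V -> V) y.
  by have := open_nbhs_nbhs (conj oU Ux); apply: filterS => y /IH.
rewrite -deriveE; last exact: (holomorphic_lie_iter (k + N) oU hX Ux).
by rewrite (near_eq_derive _ nz) derive_cst.
Qed.

End LieIterates.
Arguments lie_iter {R n} X j : simpl never.

(** If all these power sums vanished, summing [q.[a k] = 0] over [k] would leave only the constant
    coefficient of [q] times [p], but that coefficient is the product of the [- a k]. *)
Lemma power_sum_neq0 (K : numFieldType) p (a : 'I_p -> K) : (0 < p)%N ->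
  (forall k, a k != 0) -> exists2 j, (0 < j <= p)%N & \sum_k a k ^+ j != 0.
Proof.
move=> p0 a0; apply: contrapT => H.
have s0 j : (0 < j <= p)%N -> \sum_k a k ^+ j = 0.
  by move=> jp; apply/eqP; apply: contrapT => /negP nz; apply: H; exists j.
pose q : {poly K} := \prod_(k < p) ('X - (a k)%:P).
have sq : size q = p.+1 by rewrite size_prod_XsubC /index_enum -enumT size_enum_ord.
have root_q k : q.[a k] = 0.
  by rewrite /q (bigD1 k) //= hornerM hornerXsubC subrr mul0r.
have : \sum_k q.[a k] = q`_0 * p%:R.
  transitivity (\sum_(j < p.+1) q`_j * \sum_k a k ^+ j).
    under eq_bigr do rewrite horner_coef sq.
    by rewrite exchange_big /=; apply: eq_bigr => j _; rewrite mulr_sumr.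
  rewrite big_ord_recl /= [X in _ + X]big1 ?addr0 => [|j _].
    by rewrite (eq_bigr (fun=> 1)) // sumr_const card_ord.
  by rewrite (s0 (lift ord0 j)) ?mulr0 //= /bump /= ltn_ord.
rewrite big1 // => /esym/eqP; rewrite mulf_eq0 pnatr_eq0 (gtn_eqF p0) orbF.
rewrite -horner_coef0 horner_prod; apply/negP; rewrite prodf_seq_neq0.
by apply/allP => k _; rewrite hornerXsubC sub0r oppr_eq0 a0.
Qed.

(** * Taylor expansion of solutions *)

Section Flow.
Variables (R : realType) (n : nat).
Local Notation C := (R[i]^o).
Local Notation V := ('rV[C]_n).
Implicit Types (U : set V) (X Y : V -> V).

Lemma is_derive_zero_const (W : normedModType R[i]) (f : C -> W) (r : R) :
  (forall z, nrm z < r -> is_derive z (1 : C) f 0) ->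
  forall z, nrm z < r -> f z = f 0.
Proof.
move=> df z zr; apply/eqP; rewrite -subr_eq0 -nrm_eq0 eq_le nrm_ge0 andbT.
pose D := [set w : C | nrm (0 + w *: (1 : C) - 0) <= nrm z].
have DE w : D w = (nrm w <= nrm z) :> Prop.
  by rewrite /D /= add0r subr0 [w *: _]mulr1.
have := @mean_value_le R W D f (cst 0) 0 0 z (@line_disc_midconvex _ _ _ _ _ _)
  (@line_disc_closed _ _ _ _ _ _).
rewrite mul0r; apply.
- by move=> w; rewrite DE => wz; apply: df; exact: le_lt_trans wz zr.
- by move=> w _; rewrite nrm0.
- by rewrite DE nrm0 nrm_ge0.
- by rewrite DE.
Qed.

Lemma is_derive_shiftr (W : normedModType R[i]) (u : C -> W) t h (w : W) :
  is_derive (t + h) (1 : C) u w -> is_derive h (1 : C) (fun h => u (t + h)) w.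
Proof.
move=> /is_derive_nrmP H; apply/is_derive_nrmP => e /H[d d0 Hd].
by exists d => // k /Hd; rewrite addrA.
Qed.

Definition texp i (h : C) : C := h ^+ i / i`!%:R.

Lemma is_derive_texp (W : normedModType R[i]) i (h : C) (c : W) :
  is_derive h (1 : C) (fun h => texp i h *: c)
    ((if i is k.+1 then texp k h else 0) *: c).
Proof.
have dt : is_derive h (1 : C) (texp i) (if i is k.+1 then texp k h else 0).
  case: i => [|i].
    have -> : texp 0 = cst 1 by apply/funext => z; rewrite /texp expr0 fact0 divr1.
    exact: is_derive_cst.
  have -> : texp i.+1 = (i.+1`!%:R : C)^-1 \*: (id : C -> C) ^+ i.+1.
    by apply/funext => z; rewrite /texp mulrC exprfctE.
  have dX : is_derive h (1 : C) ((id : C -> C) ^+ i.+1) ((i.+1%:R * h ^+ i) *: (1 : C)).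
    exact: is_deriveX.
  apply: is_derive_eq (is_deriveZ _ dX) _.
  rewrite /texp factS natrM [_ *: 1]mulr1 /GRing.scale /=; field.
  by rewrite nat1r !pnatr_eq0 -lt0n fact_gt0.
have [dc dE] := is_diff_scalel (texp i h) c.
by have := is_derive_comp_diff dc dt; rewrite dE.
Qed.

(** Induction on the number [m] of terms, from the vanishing iterate [N] downwards. The two sides
    agree at [h = 0], and their derivatives are the two sides of the same identity for [j.+1]. *)
Lemma flow_taylor U X N u (t : C) (r : R) : open U -> holomorphic_on U X ->
  (forall x, U x -> lie_iter X N x = 0) ->
  (forall z, nrm (z - t) < r -> U (u z) /\ is_derive z (1 : C) u (X (u z))) ->
  forall m j, (j + m = N)%N -> forall h, nrm h < r ->
  lie_iter X j (u (t + h)) = \sum_(i < m) texp i h *: lie_iter X (j + i) (u t).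
Proof.
move=> oU hX XN Hu.
have tr h : nrm h < r -> nrm (t + h - t) < r by rewrite [t + h]addrC addrK.
elim=> [|m IH] j jm h hr.
  have [Uu _] := Hu _ (tr _ hr).
  by rewrite big_ord0 -(XN _ Uu) -jm addn0.
pose F : C -> V := (fun h => lie_iter X j (u (t + h))) -
  \sum_(i < m.+1) (fun h => texp i h *: lie_iter X (j + i) (u t)).
suff : F h = F 0.
  have FE z : F z = lie_iter X j (u (t + z)) -
      \sum_(i < m.+1) texp i z *: lie_iter X (j + i) (u t).
    by rewrite /F [LHS]/= fct_sumE.
  have -> : F 0 = 0.
    rewrite FE addr0 big_ord_recl /= big1 ?addr0 => [|i _].
      by rewrite /texp expr0 fact0 divr1 scale1r addn0 subrr.
    by rewrite /texp expr0n mul0r scale0r.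
  by rewrite FE => /eqP; rewrite subr_eq0 => /eqP.
apply: (@is_derive_zero_const _ _ r) => // z zr.
have [Uz dz] := Hu _ (tr _ zr).
have dG : is_derive z (1 : C) (fun h => lie_iter X j (u (t + h)))
    (lie_iter X j.+1 (u (t + z))).
  have du := is_derive_shiftr dz.
  exact: (is_derive_comp_diff (holomorphic_lie_iter j oU hX Uz) du).
have dS : is_derive z (1 : C)
    (\sum_(i < m.+1) (fun h => texp i h *: lie_iter X (j + i) (u t)))
    (\sum_(i < m.+1) (if i : nat is k.+1 then texp k z else 0) *:
       lie_iter X (j + i) (u t)).
  by apply: is_derive_sum => i; exact: is_derive_texp.
apply: is_derive_eq (is_deriveB dG dS) _.
rewrite (IH j.+1) ?addSnnS // big_ord_recl /= scale0r add0r.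
by apply/eqP; rewrite subr_eq0; apply/eqP; apply: eq_bigr => i _; rewrite /bump /= add1n addnS.
Qed.

End Flow.

(** * Flows of rigid chambars *)

Section PolynomialFlow.
Variables (R : realType) (n : nat).
Local Notation C := (R[i]^o).
Local Notation V := ('rV[C]_n).
Implicit Types (U : set V) (X Y : V -> V).

Definition flow_coef X j (x : V) : V := (j`!%:R : C)^-1 *: lie_iter X j x.

Lemma poly_in_time0 d (F : nat -> V -> V) x : poly_in_time d F 0 x = x.
Proof.
rewrite /poly_in_time big_nat big1 ?addr0 // => i /andP[i0 _].
by rewrite expr0n gtn_eqF // scale0r.
Qed.

Lemma is_derive_scale (W : normedModType R[i]) (f : C -> W) (c t : C) l :
  is_derive (c * t) (1 : C) f l -> is_derive t (1 : C) (fun t => f (c * t)) (c *: l).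
Proof.
move=> [/derivable1_diffP df <-].
have du : is_derive t (1 : C) (c \*: (id : C -> C)) (c *: (1 : C)).
  exact: is_deriveZ.
have := is_derive_comp_diff (u := c \*: (id : C -> C)) df du.
by rewrite linearZ /= -(deriveE (1 : C) df).
Qed.

Lemma flow_polynomial U X N u (t : C) (r : R) : (0 < N)%N -> open U ->
  holomorphic_on U X -> (forall x, U x -> lie_iter X N x = 0) ->
  (forall z, nrm (z - t) < r -> U (u z) /\ is_derive z (1 : C) u (X (u z))) ->
  forall h, nrm h < r -> u (t + h) = poly_in_time N.-1 (flow_coef X) h (u t).
Proof.
move=> N0 oU hX XN Hu h hr.
rewrite -[u (t + h)]/(lie_iter X 0 (u (t + h))).
rewrite (flow_taylor oU hX XN Hu (j := 0) (add0n N) hr).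
rewrite /poly_in_time prednK //.
rewrite -(big_mkord predT (fun i => texp i h *: lie_iter X (0 + i) (u t))).
rewrite big_ltn // /texp expr0 fact0 divr1 scale1r addn0; congr (_ + _).
by apply: eq_big_nat => i _; rewrite /flow_coef scalerA add0n.
Qed.

Lemma chambar_lie_iter p U X (a : 'I_p -> C) : (0 < p)%N -> open U ->
  holomorphic_on U X -> (forall k, a k != 0) ->
  chambar U (fun k x => a k *: X x) -> forall x, U x -> lie_iter X p x = 0.
Proof.
move=> p0 oU hX a0 [_ _ _ [phi [lphi sphi]]].
have [j /andP[j0 jp] sj] := power_sum_neq0 p0 a0.
suff Gj x : U x -> lie_iter X j x = 0.
  by move=> x; exact: (lie_iter_vanish oU hX Gj jp).
move=> Ux.
have near_flow k : \forall t \near (0 : C), U (phi k t x) /\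
    is_derive t (1 : C) (phi k ^~ x) (a k *: X (phi k t x)).
  by have [] := lphi k x Ux.
have /nbhs_nrmP[r r0 Hr] : \forall t \near (0 : C), (forall k, U (phi k t x) /\
    is_derive t (1 : C) (phi k ^~ x) (a k *: X (phi k t x))) /\
    \sum_(k < p) a k *: X (phi k t x) = 0.
  apply: filterI (sphi x Ux); exact: (@filter_forall _ _ (fun k t => U (phi k t x) /\
    is_derive t (1 : C) (phi k ^~ x) (a k *: X (phi k t x)))) near_flow.
(* Each differentiation in [t] brings out one more factor [a k], because [phi k] is a flow of
   [a k *: X]. *)
have step i t : nrm t < r ->
    \sum_(k < p) a k ^+ i.+1 *: lie_iter X i.+1 (phi k t x) = 0.
  elim: i t => [|i IH] t tr.
    have [|_] := Hr t; first by rewrite subr0.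
    by move=> /= E; rewrite -[RHS]E; apply: eq_bigr => k _; rewrite expr1 lie_iter1.
  have [|Ht _] := Hr t; first by rewrite subr0.
  pose f : C -> V := \sum_(k < p) (a k ^+ i.+1 \*: (fun s => lie_iter X i.+1 (phi k s x))).
  have df : is_derive t (1 : C) f
      (\sum_(k < p) a k ^+ i.+1 *: (a k *: lie_iter X i.+2 (phi k t x))).
    apply: is_derive_sum => k; apply: is_deriveZ; have [Uk dk] := Ht k.
    have := is_derive_comp_diff (holomorphic_lie_iter i.+1 oU hX Uk) dk.
    by rewrite linearZ.
  have f0 : \forall s \near t, f s = (cst 0 : C -> V) s.
    apply/nbhs_nrmP; exists (r - nrm t); first by rewrite subr_gt0.
    move=> s st; rewrite /f fct_sumE IH //.
    by have := nrm_le_dist s t; lra.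
  have [_] := near_eq_is_derive f0 df; rewrite derive_cst => /esym E0; rewrite -[RHS]E0.
  by apply: eq_bigr => k _; rewrite scalerA -exprSr.
(* At time 0 all flows are at [x], so the sum factors as a nonzero power sum times the iterate at
   [x]. *)
have := step j.-1 0; rewrite nrm0 prednK // => /(_ r0).
under eq_bigr => k _ do rewrite (lphi k x Ux).1.
by rewrite -scaler_suml => /eqP; rewrite scaler_eq0 (negbTE sj) => /eqP.
Qed.

(** Any local flow equals its Taylor polynomial near time 0. Slowing down the flow of one [a k *: X]
    by the factor [a k] provides a flow of [X], and the polynomial inherits the flow property from
    it. *)
Lemma rigid_chambar_polynomial_flow p U X (a : 'I_p -> C) : (0 < p)%N -> open U ->
  holomorphic_on U X -> (forall k, a k != 0) ->
  chambar U (fun k x => a k *: X x) -> polynomial_flow p.-1 U X.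
Proof.
move=> p0 oU hX a0 ch; have G0 := chambar_lie_iter p0 oU hX a0 ch.
have uniq phi : local_flow U X phi -> forall x, U x ->
    \forall t \near (0 : C), phi t x = poly_in_time p.-1 (flow_coef X) t x.
  move=> lphi x Ux; have [phi0 /nbhs_nrmP[r r0 Hr]] := lphi x Ux.
  apply/nbhs_nrmP; exists r => // t; rewrite subr0 => tr.
  have := flow_polynomial p0 oU hX G0 Hr tr; by rewrite add0r phi0.
exists (flow_coef X); split => //.
  by move=> j x Ux; apply: differentiableZ; exact: (holomorphic_lie_iter j oU hX Ux).
have [_ _ _ [phi [lphi _]]] := ch.
pose k := Ordinal p0; pose psi (t : C) x := phi k ((a k)^-1 * t) x.
have lpsi : local_flow U X psi.
  move=> x Ux; have [phi0 /nbhs_nrmP[r r0 Hr]] := lphi k x Ux.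
  split; first by rewrite /psi mulr0.
  have na : 0 < nrm (a k) by rewrite nrm_gt0.
  apply/nbhs_nrmP; exists (r * nrm (a k)); first by rewrite mulr_gt0.
  move=> t; rewrite subr0 -ltr_pdivrMr // mulrC => tr.
  have [|Ut dt] := Hr ((a k)^-1 * t); first by rewrite subr0 nrmM nrmV.
  split => //; have := is_derive_scale dt.
  by rewrite scalerA mulVf // scale1r.
move=> x Ux; have [_ /nbhs_nrmP[r r0 Hr]] := lpsi x Ux.
have /nbhs_nrmP[s s0 Hs] := uniq _ lpsi x Ux.
split; first exact: poly_in_time0.
pose d := Num.min r s; have d0 : 0 < d by rewrite lt_min r0.
apply/nbhs_nrmP; exists d => // t; rewrite subr0 lt_min => /andP[tr ts].
have [|Ut dt] := Hr t; first by rewrite subr0.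
have E := Hs t; rewrite subr0 in E; rewrite -(E ts); split => //.
apply: near_eq_is_derive dt; apply/nbhs_nrmP; exists (s - nrm t).
  by rewrite subr_gt0.
by move=> z zt; apply: Hs; rewrite subr0; have := nrm_le_dist z t; lra.
Qed.

End PolynomialFlow.

(** * Orbits *)

Section Orbits.
Variables (R : realType) (n : nat).
Local Notation C := (R[i]^o).
Local Notation V := ('rV[C]_n).
Implicit Types (U : set V) (X : V -> V) (F : nat -> V -> V).

Lemma poly_eq_near (p q : {poly C}) (r : R) : 0 < r ->
  (forall h, nrm h < r -> p.[h] = q.[h]) -> p = q.
Proof.
move=> r0 pq; apply/eqP; rewrite -subr_eq0; apply/negPn/negP => nz.
(* Too many distinct roots for a nonzero polynomial of this size; dividing by at least 2 keeps them
   strictly inside the disc. *)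
pose s := [seq ((r / (k.+2)%:R)%:C : C) | k <- iota 0 (size (p - q))].
have us : uniq s.
  rewrite map_inj_uniq ?iota_uniq // => i j /complexI /(mulfI (lt0r_neq0 r0)).
  by move=> /invr_inj/eqP; rewrite eqr_nat => /eqP[].
have rs : all (root (p - q)) s.
  apply/allP => _ /mapP[k _ ->]; rewrite rootE !hornerE pq ?subrr //.
  rewrite nrmR gtr0_norm ?divr_gt0 // ltr_pdivrMr // ltr_pMr // ltr1n //.
by have := max_poly_roots nz rs us; rewrite size_map size_iota ltnn.
Qed.

Definition curve_poly d F (x : V) (i : 'I_n) : {poly C} :=
  (x 0 i)%:P + \sum_(1 <= j < d.+1) F j x 0 i *: 'X^j.

Lemma poly_in_time_coord d F t x i :
  poly_in_time d F t x 0 i = (curve_poly d F x i).[t].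
Proof.
rewrite /poly_in_time /curve_poly mxE hornerD hornerC summxE horner_sum.
by congr (_ + _); apply: eq_bigr => j _; rewrite mxE hornerZ hornerXn mulrC.
Qed.

Lemma poly_in_time_near d F (x y : V) (t : C) (r : R) : 0 < r ->
  (forall h, nrm h < r -> poly_in_time d F h y = poly_in_time d F (t + h) x) ->
  forall h, poly_in_time d F h y = poly_in_time d F (t + h) x.
Proof.
move=> r0 H h; apply/rowP => i; rewrite [LHS]poly_in_time_coord [RHS]poly_in_time_coord.
have {}H k : nrm k < r -> (curve_poly d F y i).[k] = (curve_poly d F x i).[t + k].
  by move=> /H E; rewrite -!poly_in_time_coord E.
move: (curve_poly d F y i) (curve_poly d F x i) H => p q H.
suff -> : p = q \Po (t%:P + 'X) by rewrite horner_comp hornerD hornerC hornerX.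
by apply: (poly_eq_near r0) => k /H ->; rewrite horner_comp hornerD hornerC hornerX.
Qed.

(** The induction carries a stronger invariant: the whole polynomial curve through [y] is that
    through [x] with shifted time. Such shifts compose along chains. *)
Lemma flow_orbit_image U X N x y : (0 < N)%N -> open U -> holomorphic_on U X ->
  (forall x, U x -> lie_iter X N x = 0) -> flow_orbit U X x y ->
  exists t, y = poly_in_time N.-1 (flow_coef X) t x.
Proof.
move=> N0 oU hX XN orb; pose P h y := poly_in_time N.-1 (flow_coef X) h y.
suff [t Ht] : exists t, forall h, P h y = P (t + h) x.
  by exists t; rewrite -[t]addr0 -/(P _ _) -Ht /P poly_in_time0.
elim: orb => [|D g s t oD cD Ds Dt Hg _ [t0 IH]]; first by exists 0 => h; rewrite add0r.
(* For small [h] both sides equal [g (w + h)], expanded at [w] and at [v]; as polynomials in [h]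
   they then agree everywhere. *)
have loc v : D v -> exists2 r : R, 0 < r & forall w, nrm (w - v) < r ->
    D w /\ forall h, P h (g w) = P (w - v + h) (g v).
  move=> Dv; have /nbhs_nrmP[r r0 Hr] := open_nbhs_nbhs (conj oD Dv).
  exists r; first exact: r0.
  move=> w wv; split; first exact: (Hr w wv).
  have sol z : nrm (z - v) < r -> U (g z) /\ is_derive z (1 : C) g (X (g z)).
    by move=> /Hr; exact: Hg.
  apply: (@poly_in_time_near _ _ _ _ _ (r - nrm (w - v))); first by rewrite subr_gt0.
  move=> h hr; have hv : nrm (w - v + h) < r by have := nrmD (w - v) h; lra.
  rewrite -(flow_polynomial N0 oU hX XN sol hv) (_ : v + (w - v + h) = w + h);
    last by ring.
  rewrite -(@flow_polynomial R n U X N g w (r - nrm (w - v))) // => z zw.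
  by apply: sol; have := nrm_distD w z v; lra.
(* By [loc], both [A] and its complement in [D] are open, so connectedness gives [A = D]. *)
clearbody P; pose A := [set v | D v /\ forall h, P h (g v) = P (v - s + h) (g s)].
have oA : open A.
  rewrite openE => v [Dv Av]; have [r r0 Hr] := loc v Dv.
  apply/nbhs_nrmP; exists r; first exact: r0.
  move=> w /Hr[Dw Hw]; split; first exact: Dw.
  move=> h.
  by rewrite Hw Av; congr (P _ _); ring.
have oB : open [set v | D v /\ ~ A v].
  rewrite openE => v [Dv nAv]; have [r r0 Hr] := loc v Dv.
  apply/nbhs_nrmP; exists r; first exact: r0.
  move=> w /Hr[Dw Hw]; split; first exact: Dw.
  move=> -[_ Aw]; apply: nAv; split; first exact: Dv.
  move=> h; rewrite (_ : h = w - v + (h - (w - v))); last by ring.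
  by rewrite -Hw Aw; congr (P _ _); ring.
have AD : A = D.
  apply: cD.
  - by exists s; split; [exact: Ds | move=> h; rewrite subrr add0r].
  - by exists A => //; apply/seteqP; split=> [v [Dv Av]|v []].
  - exists (~` [set v | D v /\ ~ A v]); first exact: open_closedC.
    apply/seteqP; split=> [v Av|v [Dv nB]]; first by split; [case: Av | case].
    by apply: contrapT => nA; apply: nB.
have [_ Ht] : A t by rewrite AD.
by exists (t0 + (t - s)) => h; rewrite Ht IH addrA.
Qed.

End Orbits.

(** * Zariski closures of polynomial curves *)

Section Integral.
Variable K : fieldType.

(* The variable is a root of u(Y) - u, whose leading coefficient is a unit. *)
Lemma integralOver_comp_poly (u v : {poly K}) : (1 < size u)%N ->
  integralOver (comp_poly u) v.
Proof.
move=> su; have u0 : lead_coef u != 0.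
  by rewrite lead_coef_eq0 -size_poly_gt0 (ltn_trans _ su).
pose c := (lead_coef u)^-1.
pose p : {poly {poly K}} := (c *: u)^:P - (c *: u)%:P.
have sp : size (c *: u)^:P = size u.
  by rewrite size_map_polyC size_scale // invr_eq0.
have lc : (size (- (c *: u)%:P : {poly {poly K}}) < size (c *: u)^:P)%N.
  by rewrite size_polyN sp (leq_ltn_trans (size_polyC_leq1 _)).
have pm : p \is monic.
  rewrite monicE lead_coefDl // lead_coef_map_inj //; last exact: polyC_inj.
  by rewrite lead_coefZ mulVf.
have int_const (d : K) : integralOver (comp_poly u) d%:P.
  by rewrite -[d%:P](comp_polyC d u); exact: integral_id.
have int_u : integralOver (comp_poly u) u.
  by rewrite -{2}[u]comp_polyX; exact: integral_id.
have -> : v = v^:P.['X] by rewrite -/(v \Po 'X) comp_polyXr.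
apply: (integral_horner_root pm).
- by rewrite rootE /p hornerD hornerN hornerC -/(_ \Po 'X) comp_polyXr subrr.
- apply/integral_poly => i; rewrite /p coefB coef_map coefC.
  apply: integral_sub; first exact: int_const.
  case: eqP => _; last by rewrite -(rmorph0 (comp_poly u)); exact: integral_id.
  by rewrite -mul_polyC; apply: integral_mul.
- by apply/integral_poly => i; rewrite coef_map; exact: int_const.
Qed.

(** Factors of the variable are stripped from an integral equation of [v]; since [v] is nonzero, it
    remains a root of the quotient. *)
Lemma integral_relation (u v : {poly K}) : (1 < size u)%N -> v != 0 ->
  exists q : {poly {poly K}}, q`_0 != 0 /\ root (map_poly (comp_poly u) q) v.
Proof.
move=> su v0; have [p pm pv] := integralOver_comp_poly v su.
have := monic_neq0 pm; move: {2}(size p) (leqnn (size p)) => m.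
elim: m p {pm} pv => [|m IH] p pv.
  by rewrite leqn0 size_poly_eq0 => /eqP ->; rewrite eqxx.
move=> sp p0; have [c0|c0] := eqVneq p`_0 0; last by exists p.
have /factor_theorem[q pq] : root p 0 by rewrite rootE horner_coef0 c0.
rewrite subr0 in pq.
have q0 : q != 0 by apply: contraNneq p0 => q0; rewrite pq q0 mul0r.
apply: (IH q) => //.
  by move: pv; rewrite pq rmorphM /= map_polyX rootM rootX (negbTE v0) orbF.
by rewrite -ltnS -(size_mulX q0) -pq.
Qed.

End Integral.

Import -(notations) mpoly.

(** * Zariski closed sets and irreducibility *)

Section Zariski.
Variables (R : realType) (n : nat).
Local Notation C := (R[i]^o).
Local Notation V := ('rV[C]_n).
Local Notation MP := (mpoly.mpoly n C).
Implicit Types (S T Z : set V) (f g : MP) (x y z : V).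

Definition meval_at x f : C := mpoly.meval (fun i => x 0 i) f.

Definition coord_mpoly (i : 'I_n) (p : {poly C}) : MP :=
  \sum_(k < size p) mpoly.mpolyC n p`_k * mpoly.mpolyX C (mpoly.mnm1 i) ^+ k.

Lemma meval_coord x i p : meval_at x (coord_mpoly i p) = p.[x 0 i].
Proof.
rewrite /meval_at /coord_mpoly rmorph_sum horner_coef; apply: eq_bigr => k _.
by rewrite rmorphM rmorphXn /= mpoly.mevalC mpoly.mevalXU.
Qed.

Lemma meval_curve (c : 'I_n -> {poly C}) f :
  exists p : {poly C}, forall t, p.[t] = meval_at (\row_i (c i).[t]) f.
Proof.
exists (mpoly.mmap (@polyC C) c f) => t.
rewrite /meval_at mpoly.mevalE /mpoly.mmap horner_sum; apply: eq_bigr => m _.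
rewrite hornerM hornerC /mpoly.mmap1 horner_prod; congr (_ * _).
by apply: eq_bigr => i _; rewrite horner_exp mxE.
Qed.

Lemma zariski_closureP T x : zariski_closure T x <->
  forall f, (forall y, T y -> meval_at y f = 0) -> meval_at x f = 0.
Proof.
split=> [Tx f Tf|H Z [[I ->] TZ] f If]; last by apply: H => y /TZ; exact.
apply: (Tx (zero_locus [set f])) => //; split; first by exists [set f].
by move=> y Ty g ->; exact: Tf.
Qed.

Lemma subset_zariski_closure T : T `<=` zariski_closure T.
Proof. by move=> x Tx; apply/zariski_closureP => f; exact. Qed.

Lemma algebraic_zariski_closure T : algebraic_set (zariski_closure T).
Proof.
exists [set f | forall y, T y -> meval_at y f = 0].
by apply/seteqP; split=> x /zariski_closureP.
Qed.

Lemma algebraic_setI_zero Z f : algebraic_set Z ->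
  algebraic_set [set x | Z x /\ meval_at x f = 0].
Proof.
move=> [I ->]; exists (I `|` [set f]); apply/seteqP; split=> [x [Ix fx] g [|->//]|x Ix].
  exact: Ix.
by split=> [g Ig|]; apply: Ix; [left | right].
Qed.

(** The ideal of an irreducible set is prime: [Z] is the union of its intersections with the zero
    sets of [f] and [g]. *)
Lemma irreducible_integral Z f g : irreducible_algebraic Z ->
  (forall z, Z z -> meval_at z f * meval_at z g = 0) ->
  (forall z, Z z -> meval_at z f = 0) \/ (forall z, Z z -> meval_at z g = 0).
Proof.
move=> [aZ _ iZ] fg.
have [|E|E] := iZ _ _ (algebraic_setI_zero f aZ) (algebraic_setI_zero g aZ).
- apply/seteqP; split=> [z Zz|z [[]|[]]//].
  have /eqP := fg z Zz; rewrite mulf_eq0 => /orP[/eqP h|/eqP h]; [left|right];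
    by split.
- by left => z; rewrite {1}E => -[].
- by right => z; rewrite {1}E => -[].
Qed.

(** Over the complex numbers [p] splits, and by primality one of its linear factors vanishes on all
    of [Z]. *)
Lemma irreducible_coord_const Z (i : 'I_n) (p : {poly C}) :
  irreducible_algebraic Z -> p != 0 -> (forall z, Z z -> p.[z 0 i] = 0) ->
  exists c, forall z, Z z -> z 0 i = c.
Proof.
move=> iZ; have [_ [z0 Zz0] _] := iZ.
have [m] := ubnP (size p); elim: m p => // m IH p; rewrite ltnS => sp p0 pZ.
have /closed_rootP[c pc] : size p != 1.
  by apply/negP => /size_poly1P[d d0 pd]; have := pZ z0 Zz0; rewrite pd hornerC; apply/eqP.
have /factor_theorem[q pq] := pc.
have q0 : q != 0 by apply: contraNneq p0 => q0; rewrite pq q0 mul0r.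
have qc z : Z z -> meval_at z (coord_mpoly i q) * meval_at z (coord_mpoly i ('X - c%:P)) = 0.
  by move=> Zz; rewrite !meval_coord -hornerM -pq pZ.
have [H|H] := irreducible_integral iZ qc.
- apply: (IH q) => // [|z Zz]; last by rewrite -meval_coord H.
  by apply: leq_trans sp; rewrite pq size_Mmonic ?monicXsubC // size_XsubC addn2.
- by exists c => z /H; rewrite meval_coord hornerXsubC => /eqP; rewrite subr_eq0 => /eqP.
Qed.

Lemma irreducible_point x : irreducible_algebraic [set x].
Proof.
split; [|by exists x|].
  exists [set f | meval_at x f = 0]; apply/seteqP; split=> [y -> f //|y H].
  apply/rowP => i; have := H (coord_mpoly i ('X - (x 0 i)%:P)).
  rewrite -/(meval_at y _) /= !meval_coord !hornerXsubC subrr => /(_ erefl)/eqP.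
  by rewrite subr_eq0 => /eqP.
move=> T1 T2 _ _ E.
have : [set x] x by []; rewrite {1}E => -[Tx|Tx]; [left|right]; apply/seteqP.
- by split=> [y ->|y Ty] //; rewrite E; left.
- by split=> [y ->|y Ty] //; rewrite E; right.
Qed.

End Zariski.

(** * Zariski closures of polynomial curves *)

Section PolynomialCurve.
Variables (R : realType) (n : nat).
Local Notation C := (R[i]^o).
Local Notation V := ('rV[C]_n).
Implicit Types (c : 'I_n -> {poly C}).

Lemma rational_image_poly c (x : V) :
  rational_image c (fun=> 1) x <-> exists t, x = \row_i (c i).[t].
Proof.
split=> [[t _ ->]|[t ->]]; exists t.
- by apply/rowP => i; rewrite !mxE hornerC divr1.
- by move=> i; rewrite hornerC oner_eq0.
- by apply/rowP => i; rewrite !mxE hornerC divr1.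
Qed.

Lemma poly_eq0_everywhere (p : {poly C}) : (forall t, p.[t] = 0) -> p = 0.
Proof. by move=> H; apply: (@poly_eq_near R p 0 1) => // h _; rewrite H horner0. Qed.

Definition curve_closure c : set V := zariski_closure (rational_image c (fun=> 1)).

Lemma curve_closure_eq0 c (f : mpoly.mpoly n C) :
  (forall t, meval_at (\row_i (c i).[t]) f = 0) ->
  forall y, curve_closure c y -> meval_at y f = 0.
Proof.
move=> H y /zariski_closureP; apply => z /rational_image_poly[t ->]; exact: H.
Qed.

Lemma curve_closure_point c t : curve_closure c (\row_i (c i).[t]).
Proof. by apply: subset_zariski_closure; apply/rational_image_poly; exists t. Qed.

Lemma irreducible_curve_closure c : irreducible_algebraic (curve_closure c).
Proof.
split; first exact: algebraic_zariski_closure.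
  by exists (\row_i (c i).[0]); exact: curve_closure_point.
move=> T1 T2 [I1 E1] [I2 E2] E.
(* A proper closed subset meets the curve only at parameters that are roots of one nonzero
   polynomial, so two such subsets cannot cover the curve. *)
have dich T I : T = zero_locus I -> T `<=` curve_closure c ->
    curve_closure c = T \/ exists2 p : {poly C}, p != 0 &
      forall t, T (\row_i (c i).[t]) -> p.[t] = 0.
  move=> -> TS; have [ST|nST] := pselect (curve_closure c `<=` zero_locus I).
    by left; apply/seteqP.
  right; have [f If nf] : exists2 f, I f & ~ forall t, meval_at (\row_i (c i).[t]) f = 0.
    apply: contrapT => H; apply: nST => y Sy f If.
    apply: (curve_closure_eq0 _ Sy); apply: contrapT => nf; apply: H.
    by exists f.
  have [p Hp] := meval_curve c f; exists p.
    by apply/eqP => p0; apply: nf => t; rewrite -Hp p0 horner0.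
  by move=> t Tt; rewrite Hp; exact: Tt.
have [|//|[p1 p10 H1]] := dich _ _ E1; first by rewrite E; left.
  by left.
have [|//|[p2 p20 H2]] := dich _ _ E2; first by rewrite E; right.
  by right.
suff : p1 * p2 = 0 by move/eqP; rewrite mulf_eq0 (negbTE p10) (negbTE p20).
apply: poly_eq0_everywhere => t; rewrite hornerM.
have := @curve_closure_point c t; rewrite E => -[/H1|/H2] ->.
  by rewrite mul0r.
by rewrite mulr0.
Qed.

(** An algebraic relation between polynomials in the parameter is the vanishing of [h] on the curve,
    and thus on its closure. *)
Lemma curve_closure_relation c i (f : mpoly.mpoly n C) (v : {poly C}) (q : {poly {poly C}}) :
  (forall t, v.[t] = meval_at (\row_i (c i).[t]) f) ->
  root (map_poly (comp_poly (c i)) q) v -> forall y, curve_closure c y ->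
  \sum_(k < size q) (q`_k).[y 0 i] * meval_at y f ^+ k = 0.
Proof.
move=> Hv /rootP qv y Sy.
pose h : mpoly.mpoly n C := \sum_(k < size q) coord_mpoly i q`_k * f ^+ k.
have hE z : meval_at z h = \sum_(k < size q) (q`_k).[z 0 i] * meval_at z f ^+ k.
  rewrite /meval_at /h rmorph_sum; apply: eq_bigr => k _.
  by rewrite rmorphM rmorphXn /=; congr (_ * _); exact: meval_coord.
rewrite -hE; apply: (curve_closure_eq0 _ Sy) => t; rewrite hE -Hv mxE.
transitivity ((map_poly (comp_poly (c i)) q).[v]).[t]; last by rewrite qv horner0.
rewrite (horner_coef_wide _ (size_poly _ _)) horner_sum; apply: eq_bigr => k _.
by rewrite coef_map hornerM horner_exp horner_comp.
Qed.

Lemma rational_curve_closure c i : (1 < size (c i))%N ->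
  rational_curve (curve_closure c).
Proof.
move=> ci; split; last first.
  by exists c, (fun=> 1); split => // j; exact: oner_neq0.
have iS := irreducible_curve_closure c; split=> //.
  (* A single point is a proper subset because [c i] is not constant. *)
  pose x : V := \row_i (c i).[0]; exists [set x]; first exact: irreducible_point.
  split; first by move=> _ ->; exact: curve_closure_point.
  move=> H; have ct t : (c i).[t] = (c i).[0].
    have /(congr1 (fun v : V => v 0 i)) : \row_i (c i).[t] = x := H _ (@curve_closure_point c t).
    by rewrite !mxE.
  suff E : c i = ((c i).[0])%:P by move: ci; rewrite E ltnNge size_polyC_leq1.
  apply/eqP; rewrite -subr_eq0; apply/eqP; apply: poly_eq0_everywhere => t.
  by rewrite !hornerE ct subrr.
move=> Z1 Z2 [_ [z1 Zz1] _] iZ2 [Z12 nZ21] [Z2S nSZ2]; apply: nZ21.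
have [[I E] _ _] := iZ2.
have [f If nf] : exists2 f, I f & ~ forall t, meval_at (\row_i (c i).[t]) f = 0.
  apply: contrapT => H; apply: nSZ2 => y Sy; rewrite E => f If.
  by apply: (curve_closure_eq0 _ Sy); apply: contrapT => nf; apply: H; exists f.
have [v Hv] := meval_curve c f.
have v0 : v != 0 by apply/eqP => v0; apply: nf => t; rewrite -Hv v0 horner0.
(* As [f] vanishes on [Z2], only the constant coefficient of [q] survives there: a nonzero
   polynomial in coordinate [i]. *)
have [q [q0 qv]] := integral_relation ci v0.
have [a Ha] : exists a, forall z, Z2 z -> z 0 i = a.
  apply: (irreducible_coord_const iZ2 q0) => z Zz.
  have fz : meval_at z f = 0 by move: Zz; rewrite E; apply.
  have := curve_closure_relation Hv qv (Z2S _ Zz).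
  have [s0|s0] := posnP (size q).
    by move: q0; rewrite nth_default ?eqxx // s0.
  rewrite -(big_mkord predT (fun k => (q`_k).[z 0 i] * meval_at z f ^+ k)) big_ltn //.
  rewrite expr0 mulr1 big_nat big1 ?addr0 // => k /andP[k0 _].
  by rewrite fz expr0n gtn_eqF // mulr0.
have coord l : exists b, forall z, Z2 z -> z 0 l = b.
  have [s sm sl] := integralOver_comp_poly (c l) ci.
  (* Specializing coordinate [i] to its value [a] on [Z2] keeps the integral equation monic, hence
     nonzero. *)
  pose p := map_poly (horner_eval a) s.
  have p0 : p != 0 := monic_neq0 (monic_map (horner_eval a) sm).
  apply: (irreducible_coord_const iZ2 p0) => z Zz.
  have Hl t : (c l).[t] = meval_at (\row_i (c i).[t]) (coord_mpoly l 'X).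
    by rewrite meval_coord hornerX mxE.
  have := curve_closure_relation Hl sl (Z2S _ Zz).
  rewrite meval_coord hornerX (Ha _ Zz) => <-.
  rewrite (horner_coef_wide _ (size_poly _ _)); apply: eq_bigr => k _.
  by rewrite coef_map.
(* All coordinates are constant on [Z2], so it reduces to the point [z1] of [Z1], against strict
   inclusion. *)
move=> z Zz; suff -> : z = z1 by [].
by apply/rowP => l; have [b Hb] := coord l; rewrite !Hb //; exact: Z12.
Qed.

End PolynomialCurve.

Theorem theorem2 (R : realType) (n p : nat) (U : set 'rV[R[i]^o]_n)
    (X : 'rV[R[i]^o]_n -> 'rV[R[i]^o]_n) (a : 'I_p -> R[i]^o) :
  (0 < p)%N -> open U -> connected U -> holomorphic_on U X ->
  (forall k, a k != 0) ->
  chambar U (fun k x => a k *: X x) ->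
  polynomial_flow p.-1 U X /\
  (forall x, U x ->
     flow_orbit U X x = [set x] \/
     exists2 S, rational_curve S & flow_orbit U X x `<=` S).
Proof.
move=> p0 oU _ hX a0 ch.
split; first exact: rigid_chambar_polynomial_flow p0 oU hX a0 ch.
move=> x Ux; have G0 := chambar_lie_iter p0 oU hX a0 ch.
pose c := curve_poly p.-1 (flow_coef X) x.
have orbit_c y : flow_orbit U X x y -> exists t, y = \row_i (c i).[t].
  move=> /(flow_orbit_image p0 oU hX G0)[t ->]; exists t.
  by apply/rowP => i; rewrite poly_in_time_coord mxE.
(* Either some coordinate of the curve is nonconstant and its closure is a rational curve, or the
   curve stays at [x]. *)
have [[i ci]|nc] := pselect (exists i, 1 < size (c i))%N; [right|left].
  exists (curve_closure c); first exact: rational_curve_closure ci.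
  by move=> y /orbit_c[t ->]; exact: curve_closure_point.
have x_c t : \row_i (c i).[t] = x.
  apply/rowP => i; rewrite mxE -[in RHS](poly_in_time0 p.-1 (flow_coef X) x).
  rewrite poly_in_time_coord -/(c i).
  have /size1_polyC -> : (size (c i) <= 1)%N.
    by rewrite leqNgt; apply/negP => ci; apply: nc; exists i.
  by rewrite !hornerC.
apply/seteqP; split=> [y /orbit_c[t ->]|_ ->]; first exact: x_c.
exact: flow_orbit_refl.
Qed.
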